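(* Let $\rho_{AB}$ be a bipartite state acting on a separable Hilbert space $\mathcal{H}_A\otimes\mathcal{H}_B$. Then $$\log_2\!\left(2^{E_\kappa(\rho_{AB})}-1\right)\le E^{(1)}_{\mathrm{PPT}}(\rho_{AB})\le\log_2\!\left(2^{E_\kappa(\rho_{AB})}+2\right).$$
   Context: A bipartite state $\rho_{AB}$ is a positive semi-definite operator of unit trace on $\mathcal{H}_A\otimes\mathcal{H}_B$. The partial transpose with respect to a fixed orthonormal basis $\{|i\rangle_B\}_i$ is the linear map $T_B(X_{AB})=X_{AB}^{T_B}:=\sum_{i,j}(I_A\otimes|i\rangle\langle j|_B)X_{AB}(I_A\otimes|i\rangle\langle j|_B)$. A quantum channel is a completely positive trace-preserving map. A bipartite channel $\mathcal{N}_{AB\to A'B'}$ (Alice holds $A,A'$, Bob holds $B,B'$) is completely PPT-preserving (C-PPT-P), written $\mathcal{N}\in\mathrm{PPT}$, if $T_{B'}\circ\mathcal{N}_{AB\to A'B'}\circ T_B$ is completely positive. For $d\in\mathbb{N}=\{1,2,\dots\}$, the maximally entangled state of Schmidt rank $d$ is $\Phi^d_{\hat A\hat B}:=\frac1d\sum_{i,j=1}^d|i\rangle\langle j|_{\hat A}\otimes|i\rangle\langle j|_{\hat B}$, where $\hat A,\hat B$ have dimension $d$ with orthonormal bases $\{|i\rangle_{\hat A}\}_i$, $\{|i\rangle_{\hat B}\}_i$. One-shot PPT exact entanglement cost: $E^{(1)}_{\mathrm{PPT}}(\rho_{AB}):=\inf\{\log_2 d: d\in\mathbb{N},\ \Lambda_{\hat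 A\hat B\to AB}\in\mathrm{PPT},\ \rho_{AB}=\Lambda_{\hat A\hat B\to AB}(\Phi^d_{\hat A\hat B})\}$. $\kappa$-entanglement: $E_\kappa(\rho_{AB}):=\inf\{\log_2\operatorname{Tr}[S_{AB}]: S_{AB}\ge0,\ -S_{AB}^{T_B}\le\rho_{AB}^{T_B}\le S_{AB}^{T_B}\}$, the infimum being over trace-class operators $S_{AB}$. Conventions: the infimum of the empty set is $+\infty$; $\log_2 0=-\infty$ (so the lower bound is $-\infty$ when $E_\kappa(\rho_{AB})=0$). *)

(* Defs.v *)
From HB Require Import structures.
From mathcomp Require Import all_boot all_order all_algebra finmap.
From mathcomp Require Import all_classical all_reals all_analysis.
From mathcomp.analysis.showcase Require summability.
From mathcomp.real_closed Require Import complex.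

Set Implicit Arguments.
Unset Strict Implicit.
Unset Printing Implicit Defensive.

Import Order.TTheory GRing.Theory Num.Theory numFieldNormedType.Exports.

Local Open Scope classical_set_scope.
Local Open Scope ring_scope.

(* Complex Hilbert spaces: complete normed spaces over R[i] whose norm comes
   from an inner product, linear in its second argument (physics convention).
   The norm of such a space takes values in R[i].                              *)
HB.mixin Record NormedModule_hasInner (R : realType) H
    of NormedModule R[i] H := {
  inner : H -> H -> R[i] ;
  inner_linear : forall (x : H) (a : R[i]) (y z : H),
    inner x (a *: y + z) = a * inner x y + inner x z ;
  inner_conj : forall x y : H, inner y x = (inner x y)^* ;
  inner_norm : forall x : H, inner x x = `|x| ^+ 2
}.

#[short(type="hilbertType")]
HB.structure Definition Hilbert (R : realType) :=
  {H of CompleteNormedModule R[i] H & NormedModule_hasInner R H}.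

Definition separable (T : topologicalType) : Prop :=
  exists2 D : set T, countable D & dense D.

Section operators.
Context {R : realType}.
Implicit Types H K : hilbertType R.

Definition orthonormal_basis H (I : choiceType) (e : I -> H) : Prop :=
  (forall i j, inner (e i) (e j) = (i == j)%:R) /\
  dense [set x | exists (s : seq I) (c : I -> R[i]),
                   x = \sum_(i <- s) c i *: e i].

(* Operators are plain functions H -> H, with their pointwise vector space
   structure.                                                                  *)
Definition bounded_op H (X : H -> H) : Prop := linear X /\ continuous X.

Definition psd H (X : H -> H) : Prop :=
  bounded_op X /\ forall x, 0 <= inner x (X x).

Definition loewner_le H (X Y : H -> H) : Prop :=
  forall x, 0 <= inner x (Y x - X x).

Definition ketbra H (x y : H) : H -> H := fun z => inner y z *: x.

(* id_k (x) N, acting on k x k blocks of operators of the class D on which N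
   is defined, is positive for every k.                                        *)
Definition block_psd H (k : nat) (X : 'I_k -> 'I_k -> H -> H) : Prop :=
  forall x : 'I_k -> H, 0 <= \sum_a \sum_b inner (x a) (X a b (x b)).

Definition completely_positive H K (D : set (H -> H))
    (N : (H -> H) -> (K -> K)) : Prop :=
  forall (k : nat) (X : 'I_k -> 'I_k -> H -> H),
    (forall a b, D (X a b)) -> block_psd X -> block_psd (fun a b => N (X a b)).

End operators.

(* A Hilbert space tensor product, with an orthonormal basis of each factor.   *)
Record bipartite (R : realType) (I J : choiceType) := Bipartite {
  alice : hilbertType R ;
  bob : hilbertType R ;
  joint :> hilbertType R ;
  tens : alice -> bob -> joint ;
  tens_linear_l : forall b, linear (tens^~ b) ;
  tens_linear_r : forall a, linear (tens a) ;
  tens_inner : forall a b a' b',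
    inner (tens a b) (tens a' b') = inner a a' * inner b b' ;
  tens_dense : dense [set x | exists s : seq (alice * bob),
                                x = \sum_(p <- s) tens p.1 p.2] ;
  basisA : I -> alice ;
  basisB : J -> bob ;
  basisA_onb : orthonormal_basis basisA ;
  basisB_onb : orthonormal_basis basisB
}.

Section bipartite_operators.
Context {R : realType} {I J : choiceType} (AB : bipartite R I J).
Local Notation op := (AB -> AB).

Definition basisAB (p : I * J) : AB := tens (basisA AB p.1) (basisB AB p.2).

(* S (x) T: the bounded operator mapping a (x) b to S a (x) T b (unique by
   density of the simple tensors).                                             *)
Definition tens_op (S : alice AB -> alice AB) (T : bob AB -> bob AB) : op :=
  xget (fun=> 0) [set Y : op | bounded_op Y /\
                    forall a b, Y (tens a b) = tens (S a) (T b)].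

(* Trace-class operators: the linear span of the positive operators P with
   Tr P < oo (Pedersen, Analysis Now, 3.4), i.e. those X with Tr |X| < oo.     *)
Definition psd_finite_trace (P : op) : Prop :=
  psd P /\ (\esum_(p in [set: I * J])
      (complex.Re (inner (basisAB p) (P (basisAB p))))%:E < +oo)%E.

Definition trace_class : set op :=
  [set X | exists (n : nat) (c : 'I_n -> R[i]) (P : 'I_n -> op),
             (forall k, psd_finite_trace (P k)) /\ X = \sum_k c k *: P k].

(* summability.sum is the limit of the partial sums over finite sets of
   indices. R[i]^o is R[i] seen as a normed space.                             *)
Definition trace (X : op) : R[i] :=
  summability.sum (R := R[i]^o)
    (fun p : I * J => inner (basisAB p) (X (basisAB p))).

Definition is_state (rho : op) : Prop :=
  [/\ psd rho, trace_class rho & trace rho = 1].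

(* sum_(i,j) (1 (x) |i><j|) X (1 (x) |i><j|), converging strongly. It need not
   be trace class even if X is.                                                *)
Definition ptranspose (X : op) : op := fun x =>
  let L p := tens_op id (ketbra (basisB AB p.1) (basisB AB p.2)) in
  summability.sum (fun p : J * J => L p (X (L p x))).

End bipartite_operators.

Section channels.
Context {R : realType} {I J I' J' : choiceType}.
Variables (AB : bipartite R I J) (AB' : bipartite R I' J').

(* A channel is given by its values on trace-class operators; the values
   elsewhere are irrelevant.                                                   *)
Definition is_channel (N : (AB -> AB) -> (AB' -> AB')) : Prop :=
  [/\ forall X, trace_class X -> trace_class (N X),
      forall (a : R[i]) X Y, trace_class X -> trace_class Y ->
        N (a *: X + Y) = a *: N X + N Y,
      forall X, trace_class X -> trace (N X) = trace X
    & completely_positive (@trace_class R I J AB) N].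

(* The map T_B' o N o T_B is defined on those trace-class X whose partial
   transpose is trace class: on all operators if AB is finite dimensional.     *)
Definition ppt_channel (N : (AB -> AB) -> (AB' -> AB')) : Prop :=
  is_channel N /\
  completely_positive
    [set X : AB -> AB | trace_class X /\ trace_class (ptranspose X)]
    (fun X => ptranspose (N (ptranspose X))).

End channels.

Definition max_entangled (R : realType) (d : nat)
    (Q : bipartite R 'I_d 'I_d) : Q -> Q :=
  (d%:R)^-1 *: \sum_(i < d) \sum_(j < d)
    tens_op (ketbra (basisA Q i) (basisA Q j))
            (ketbra (basisB Q i) (basisB Q j)).
Arguments max_entangled {R d} Q.

Section costs.
Context {R : realType}.
Local Open Scope ereal_scope.

(* log2 0 = -oo, log2 +oo = +oo, exp2 -oo = 0, exp2 +oo = +oo.                 *)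
Definition log2 (x : \bar R) : \bar R := lne x * ((ln 2)^-1)%:E.
Definition exp2 (x : \bar R) : \bar R := expeR (x * (ln 2)%:E).

Context {I J : choiceType} {AB : bipartite R I J}.

Definition E_ppt1 (rho : AB -> AB) : \bar R :=
  ereal_inf [set x | exists (d : nat) (Q : bipartite R 'I_d 'I_d)
                            (L : (Q -> Q) -> (AB -> AB)),
    [/\ (0 < d)%N, ppt_channel L, rho = L (max_entangled Q)
      & x = log2 (d%:R)%:E]].

Definition E_kappa (rho : AB -> AB) : \bar R :=
  ereal_inf [set log2 (complex.Re (trace S))%:E | S in
    [set S : AB -> AB | [/\ psd S, trace_class S,
       loewner_le (- ptranspose S)%R (ptranspose rho)
     & loewner_le (ptranspose rho) (ptranspose S)]]].

End costs.

(* Main.v *)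
Require Import Defs.
From HB Require Import structures.
From mathcomp Require Import all_boot all_order all_algebra finmap.
From mathcomp Require Import all_classical all_reals all_analysis.
From mathcomp.analysis.showcase Require summability.
From mathcomp.real_closed Require Import complex.
From mathcomp Require Import ring.

(* Converse: F = d T_B(Phi^d) is the flip, so (1 +- F)/d >= 0 is mapped by
   T_B o L o T_B to T_B(L(1/d)) +- T_B(rho) >= 0. Hence S = L(1/d) is feasible,
   and Tr S = d; this gives even E_kappa <= E_ppt1.

   Achievability: for S feasible, m = Tr S and d >= m + 1, put
     L X = Tr(Phi^d X) rho + (Tr X - Tr(Phi^d X)) S/m.
   Both coefficients are completely positive functionals, and T_B o L o T_B
   is X |-> Tr(P+ X) Y+ + Tr(P- X) Y-, where P+- = (1 +- F)/2 and
   Y+- = (+- T_B(rho) + (d -+ 1) T_B(S)/m)/d >= 0.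

   In infinite dimension, T_B(X) x is the sum of the vectors V X V x over all
   V = 1 (x) |i><j|. For X >= 0, Cauchy-Schwarz for the form <u, X v> bounds
   the squared norm of a finite partial sum by Tr X times the sum of the
   energies <V x, X V x>, and the sum of all energies is at most Tr X |x|^2;
   so the series converges unconditionally. *)

Set Implicit Arguments.
Unset Strict Implicit.
Unset Printing Implicit Defensive.

Import Order.TTheory GRing.Theory Num.Theory numFieldNormedType.Exports.

Local Open Scope classical_set_scope.
Local Open Scope ring_scope.
Local Notation "x %:C" := (real_complex _ x) : ring_scope.
Local Notation sum := summability.sum.
Local Notation partial_sum := summability.partial_sum.
Local Notation totally := summability.totally.
Local Existing Instance summability.totally_filter.

(** In the achievability part complete positivity is reduced to Schur products. If f is a completely
    positive functional and Y >= 0, the block form of X |-> f(X) Y is the sum of the f(X_ab) <x_a, Y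
    x_b>, a positive matrix multiplied entrywise by a Gram matrix. Of Y this uses only linearity and
    nonnegativity of its quadratic form, which matters because Y+- contain partial transposes,
    possibly outside the trace class.

    The size of d enters through Y+-. Given T_B(S) >= 0, the inequality T_B(rho) >= -T_B(S) makes Y+
    >= 0 once (d - 1)/m >= 1, and T_B(rho) <= T_B(S) makes Y- >= 0 already for (d + 1)/m >= 1. Some
    integer d satisfies m + 1 <= d <= m + 2, whence the constant 2.

    Scalars and norms are complex, with a partial order. Suprema are therefore taken over real
    parts, and convergence is obtained from real families with bounded partial sums. The estimates
    are stated for semidefinite forms, so that one Cauchy-Schwarz inequality serves <u, X v>, finite
    families of such forms, and Euclidean spaces that have no norm yet. *)

Section inner_theory.
Context {R : realType}.
(* The topology of the scalars is inferred from a numFieldType, not from R[i]. *)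
Let C : numFieldType := R[i].

Lemma cvg_norm_sq (T : Type) (F : set_system T) {FF : Filter F} (V : normedModType C)
    (f : T -> V) (x : V) :
  f @ F --> x -> (fun t => `|f t| ^+ 2 : C) @ F --> (`|x| ^+ 2 : C).
Proof.
move=> fx; under eq_fun do rewrite expr2.
by rewrite expr2; apply: cvgM; apply: cvg_norm.
Qed.

(** * Sesquilinear algebra and continuity of the inner product *)

Section algebra.
Context {H : hilbertType R}.
Implicit Types x y z : H.

Lemma inner0r x : inner x 0 = 0 :> C.
Proof.
have := inner_linear x 1 (0 : H) 0; rewrite scale1r addr0 mul1r => /eqP.
by rewrite -subr_eq subrr => /eqP.
Qed.

Lemma innerDr x y z : inner x (y + z) = inner x y + inner x z :> C.
Proof. by rewrite -{1}(scale1r y) inner_linear mul1r. Qed.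

Lemma innerZr x (a : C) y : inner x (a *: y) = a * inner x y.
Proof. by rewrite -[a *: y]addr0 inner_linear inner0r addr0. Qed.

Lemma innerNr x y : inner x (- y) = - inner x y :> C.
Proof. by rewrite -scaleN1r innerZr mulN1r. Qed.

Lemma innerBr x y z : inner x (y - z) = inner x y - inner x z :> C.
Proof. by rewrite innerDr innerNr. Qed.

Lemma inner0l x : inner 0 x = 0 :> C.
Proof. by rewrite inner_conj inner0r conjC0. Qed.

Lemma innerDl x y z : inner (y + z) x = inner y x + inner z x :> C.
Proof. by rewrite inner_conj innerDr rmorphD /= -!inner_conj. Qed.

Lemma innerZl x (a : C) y : inner (a *: y) x = a^* * inner y x.
Proof. by rewrite inner_conj innerZr rmorphM /= -inner_conj. Qed.

Lemma innerNl x y : inner (- y) x = - inner y x :> C.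
Proof. by rewrite -scaleN1r innerZl rmorphN rmorph1 mulN1r. Qed.

Lemma innerBl x y z : inner (y - z) x = inner y x - inner z x :> C.
Proof. by rewrite innerDl innerNl. Qed.

Lemma inner_sumr x (K : Type) (s : seq K) (P : pred K) (f : K -> H) :
  inner x (\sum_(k <- s | P k) f k) = \sum_(k <- s | P k) inner x (f k) :> C.
Proof.
by apply: (big_morph (inner x)) => [y z|]; [exact: innerDr|exact: inner0r].
Qed.

Lemma inner_suml x (K : Type) (s : seq K) (P : pred K) (f : K -> H) :
  inner (\sum_(k <- s | P k) f k) x = \sum_(k <- s | P k) inner (f k) x :> C.
Proof.
by apply: (big_morph (inner^~ x)) => [y z|]; [exact: innerDl|exact: inner0l].
Qed.

Lemma inner_ge0 x : 0 <= inner x x :> C.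
Proof. by rewrite inner_norm exprn_ge0. Qed.

(** Polarization reduces continuity of the inner product to continuity of the norm. The signs of the
    terms with ['i] reflect linearity in the second argument. *)
Lemma inner_polarization x y : inner x y = 4^-1 * (`|x + y| ^+ 2 - `|x - y| ^+ 2
  - 'i * `|x + 'i *: y| ^+ 2 + 'i * `|x - 'i *: y| ^+ 2) :> C.
Proof.
rewrite -!inner_norm !(innerDl, innerDr, innerNl, innerNr, innerZl, innerZr).
rewrite conjCi.
have i2 : 'i * 'i = -1 :> C by rewrite -expr2 sqrCi.
by field: i2.
Qed.

Lemma inner_cvg (T : Type) (F : set_system T) {FF : Filter F} (f g : T -> H) x y :
  f @ F --> x -> g @ F --> y -> (fun t => inner (f t) (g t) : C) @ F --> (inner x y : C).
Proof.
move=> fx gy; rewrite inner_polarization.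
under eq_fun do rewrite inner_polarization.
have fiy : (fun t => 'i *: g t) @ F --> 'i *: y by exact: cvgZl_tmp.
apply: cvgM; first exact: cvg_cst.
apply: cvgD; last by apply: cvgM; [exact: cvg_cst|apply: cvg_norm_sq; exact: cvgB].
apply: cvgB; last by apply: cvgM; [exact: cvg_cst|apply: cvg_norm_sq; exact: cvgD].
by apply: cvgB; apply: cvg_norm_sq; [exact: cvgD|exact: cvgB].
Qed.


End algebra.

(** Neither symmetry nor definiteness is demanded: symmetry follows from positivity over the complex
    numbers, and degenerate forms <u, X v> must be covered. *)
Definition psd_form (V : lmodType C) (B : V -> V -> C) : Prop :=
  [/\ forall x a y z, B x (a *: y + z) = a * B x y + B x z,
      forall x a y z, B (a *: y + z) x = a^* * B y x + B z x
    & forall x, 0 <= B x x].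

Section psd_form_theory.
Variables (V : lmodType C) (B : V -> V -> C) (HB : psd_form B).
Implicit Types x y z : V.

Let BDr x y z : B x (y + z) = B x y + B x z.
Proof. by case: HB => Br _ _; rewrite -{1}(scale1r y) Br mul1r. Qed.
Let BDl x y z : B (y + z) x = B y x + B z x.
Proof. by case: HB => _ Bl _; rewrite -{1}(scale1r y) Bl rmorph1 mul1r. Qed.
Let B0r x : B x 0 = 0.
Proof. by apply: (addrI (B x 0)); rewrite -BDr !addr0. Qed.
Let B0l x : B 0 x = 0.
Proof. by apply: (addrI (B 0 x)); rewrite -BDl !addr0. Qed.
Let BZr x a y : B x (a *: y) = a * B x y.
Proof. by case: HB => Br _ _; rewrite -[a *: y]addr0 Br B0r addr0. Qed.
Let BZl x a y : B (a *: y) x = a^* * B y x.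
Proof. by case: HB => _ Bl _; rewrite -[a *: y]addr0 Bl B0l addr0. Qed.
Let B_ge0 x : 0 <= B x x. Proof. by case: HB. Qed.

(** Positivity at [x + y] makes the sum of [B x y] and [B y x] real, and positivity at [x + 'i *: y]
    makes their difference purely imaginary; hence they are conjugate. *)
Lemma psd_form_conj x y : B y x = (B x y)^*.
Proof.
have real z : (B z z)^* = B z z by apply: geC0_conj.
have := real (x + y); have := real (x + 'i *: y).
rewrite !(BDl, BDr, BZl, BZr) !(rmorphD, rmorphM, rmorphN, real, conjCi) /=.
rewrite !real conjCi opprK.
set b := B x y; set c := B y x => e1 e2.
have : 'i * (c + c^* - b - b^*) = 0.
  by move/eqP: e1; rewrite -subr_eq0 => /eqP <-; ring.
move/eqP; rewrite mulf_eq0 (negPf (neq0Ci _)) /= => /eqP e3.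
have e4 : 2 * (c - b^*) = 0.
  move/eqP: e2; rewrite -subr_eq0 => /eqP e2.
  have : (c + c^* - b - b^*) - (B x x + b^* + (c^* + B y y) - (B x x + b + (c + B y y))) = 0.
    by rewrite e2 e3 subr0.
  by move=> <-; ring.
by move/eqP: e4; rewrite mulf_eq0 pnatr_eq0 subr_eq0 => /eqP.
Qed.

Lemma psd_form_CS x y : `|B x y| ^+ 2 <= B x x * B y y.
Proof.
have cb := psd_form_conj x y.
set b := B x y in cb *; have p0 := B_ge0 x; have q0 := B_ge0 y.
have bb : `|b| ^+ 2 = b * b^* by exact: normCK.
have E t : 0 <= t * t^* * B x x + t^* * b + t * b^* + B y y.
  have := B_ge0 (t *: x + y).
  by rewrite !(BDl, BDr, BZl, BZr) cb -/b; set u := (X in 0 <= X -> _);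
     set v := (X in _ -> 0 <= X); suff -> : u = v by []; rewrite /u /v; ring.
have [px|px] := eqVneq (B x x) 0.
  rewrite px mul0r; have [->|b0] := eqVneq b 0; first by rewrite normr0 expr0n.
  have bn : `|b| ^+ 2 != 0 by rewrite expf_eq0 /= normr_eq0.
  have bs : (b^* * b) = `|b| ^+ 2 by rewrite bb mulrC.
  (* As [B x x = 0], the expansion [E] has no quadratic term; this [s] brings it down to -1, against
     positivity. *)
  pose s := (B y y + 1) / (2 * `|b| ^+ 2).
  have sc : s^* = s.
    by apply: geC0_conj; rewrite divr_ge0 ?addr_ge0 ?mulr_ge0 ?exprn_ge0.
  have := E (- s * b); rewrite px mulr0 add0r rmorphM rmorphN /= sc.
  have -> : - s * b^* * b + - s * b * b^* + B y y = -1.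
    rewrite -!mulrA bs -bb /s.
    by move: (`|b| ^+ 2) bn => n bn; field.
  by rewrite ler0N1.
have pp : 0 < B x x by rewrite lt_neqAle eq_sym px.
have pc : (B x x)^-1^* = (B x x)^-1 by apply: geC0_conj; rewrite invr_ge0.
(* This argument minimizes the quadratic expression in [E]. *)
have := E (- (B x x)^-1 * b); rewrite rmorphM rmorphN /= pc.
set u := (X in 0 <= X -> _).
have -> : u = (B x x)^-1 * (B x x * B y y - `|b| ^+ 2) by rewrite /u bb; field.
by rewrite pmulr_rge0 ?invr_gt0// subr_ge0.
Qed.

Lemma psd_form_null x y : B x x = 0 -> B x y = 0.
Proof.
move=> x0; have := psd_form_CS x y; rewrite x0 mul0r => h.
have : `|B x y| ^+ 2 == 0 by rewrite eq_le h exprn_ge0.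
by rewrite expf_eq0 /= normr_eq0 => /eqP.
Qed.

End psd_form_theory.

(** Cauchy-Schwarz for this direct sum estimates a whole finite sum of terms [B (u k) (v k)] at
    once. *)
Lemma psd_form_sum (V : lmodType C) (B : V -> V -> C) (K : Type) (s : seq K) :
  psd_form B -> psd_form (fun u v : K -> V => \sum_(k <- s) B (u k) (v k)).
Proof.
move=> [Br Bl B0]; split=> [x a y z|x a y z|x].
- by rewrite mulr_sumr -big_split; apply: eq_bigr => k _; exact: Br.
- by rewrite mulr_sumr -big_split; apply: eq_bigr => k _; exact: Bl.
- exact: sumr_ge0.
Qed.

Section inner_form.
Context {H : hilbertType R}.
Implicit Types x y : H.

Lemma inner_psd_form : psd_form (@inner R H).
Proof.
split=> [x a y z|x a y z|x]; [exact: inner_linear|by rewrite innerDl innerZl|].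
exact: inner_ge0.
Qed.

End inner_form.

End inner_theory.

(** * Limits of complex and vector valued functions *)

Section limits.
Context {R : realType}.
Let C : numFieldType := R[i].

Lemma eq_dense (T : topologicalType) (V : normedModType C) (f g : T -> V) (D : set T) :
  dense D -> continuous f -> continuous g -> (forall x, D x -> f x = g x) -> f = g.
Proof.
move=> dD cf cg fg; apply/funext => x; apply: contrapT => /eqP nfg.
pose h y := `|f y - g y|.
have ch : continuous (h : T -> C).
  by move=> y; apply: cvg_norm; apply: cvgB; [exact: cf|exact: cg].
have [||y [/= hy Dy]] := dD ((h : T -> C) @^-1` ~` [set 0]).
- by exists x => /= /eqP; rewrite /h normr_eq0 subr_eq0; exact/negP.
- apply: open_comp => [y _|]; first exact: ch.
  apply: closed_openC; apply: accessible_closed_set1.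
  by apply: hausdorff_accessible; exact: norm_hausdorff.
- by apply: hy; rewrite /h fg// subrr normr0.
Qed.

(** Nonnegative numbers are their own norms, so by continuity of the norm the limit is its own norm
    too. *)
Lemma ge0_lim (T : Type) (F : set_system T) {FF : ProperFilter F} (f : T -> C) (l : C) :
  f @ F --> l -> (\forall x \near F, 0 <= f x) -> 0 <= l.
Proof.
move=> fl f0.
have fl' : (fun x => `|f x| : C) @ F --> (l : C).
  apply: cvg_trans fl; apply: near_eq_cvg; near=> x.
  by rewrite ger0_norm//; near: x.
have hC : hausdorff_space C := @norm_hausdorff C C^o.
have -> : l = `|l|.
  exact: etrans (esym (cvg_lim hC fl')) (cvg_lim hC (cvg_norm fl)).
exact: normr_ge0.
Unshelve. all: by end_near.
Qed.

Lemma cvg_sum_seq (T K : Type) (F : set_system T) {FF : Filter F} (V : normedModType C)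
    (s : seq K) (f : K -> T -> V) (l : K -> V) :
  (forall k, f k @ F --> l k) ->
  (fun t => \sum_(k <- s) f k t) @ F --> \sum_(k <- s) l k.
Proof.
move=> fl; apply: cvg_big => // x; exact: add_continuous.
Qed.

End limits.

(** * Unconditional sums *)

Section unconditional_sums.
Context {R : realType}.
Let C : numFieldType := R[i].
Local Open Scope fset_scope.
Local Open Scope ring_scope.

(** [sum] is a total function whose value is informative only under convergence; this relation keeps
    convergence and value together. *)
Definition sums_to (K : choiceType) (V : normedModType C) (w : K -> V) (s : V) : Prop :=
  partial_sum w @ totally --> s.

Lemma partial_sumE (K : choiceType) (V : zmodType) (w : K -> V) (F : {fset K}) :
  partial_sum w F = \sum_(k <- F) w k.
Proof. by rewrite big_seq_fsetE. Qed.

Section normed.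
Context {K : choiceType} {V : normedModType C}.
Implicit Types (w v : K -> V) (s t : V).

Lemma sums_toE w s : sums_to w s -> sum w = s.
Proof. by move=> ws; exact: (cvg_lim (@norm_hausdorff C V) ws). Qed.

Lemma sums_to_fset w (F : {fset K}) : (forall k, k \notin F -> w k = 0) ->
  sums_to w (\sum_(k <- F) w k).
Proof.
move=> w0; apply: cvg_near_cst; exists F => //= G FG.
by rewrite partial_sumE; apply/esym/big_fset_incl => // k _; exact: w0.
Qed.

Lemma sums_to1 w (k : K) : (forall k', k' != k -> w k' = 0) -> sums_to w (w k).
Proof.
move=> w0; rewrite -(big_seq_fset1 +%R k w); apply: sums_to_fset => k'.
by rewrite inE; exact: w0.
Qed.

Lemma sums_to_zero : sums_to (fun _ : K => 0 : V) 0.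
Proof.
have := @sums_to_fset (fun=> 0) fset0 (fun _ _ => erefl).
by rewrite big_seq_fset0.
Qed.

Lemma sums_to_eq w v s : w =1 v -> sums_to w s -> sums_to v s.
Proof. by move=> /funext ->. Qed.

Lemma sums_to_lin (a : C) w v s t : sums_to w s -> sums_to v t ->
  sums_to (fun k => a *: w k + v k) (a *: s + t).
Proof.
move=> ws vt.
have E : partial_sum (fun k => a *: w k + v k) =
    (fun F => a *: partial_sum w F + partial_sum v F).
  by apply/funext => F; rewrite /partial_sum scaler_sumr -big_split.
by rewrite /sums_to E; apply: cvgD => //; exact: cvgZl_tmp.
Qed.

End normed.

Lemma sums_to_cont (K : choiceType) (V W : normedModType C) (f : V -> W)
    (w : K -> V) (s : V) :
  (forall x y, f (x + y) = f x + f y) -> continuous f ->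
  sums_to w s -> sums_to (f \o w) (f s).
Proof.
move=> fD cf ws.
have f0 : f 0 = 0 by apply: (addrI (f 0)); rewrite -fD !addr0.
have E : partial_sum (f \o w) = f \o partial_sum w.
  by apply/funext => F; rewrite /partial_sum /= (big_morph f fD f0).
by rewrite /sums_to E; apply: cvg_comp ws _; exact: cf.
Qed.

Lemma sums_to_ge0 (K : choiceType) (w : K -> C^o) (s : C) :
  sums_to w s -> (forall k, 0 <= (w k : C)) -> 0 <= s.
Proof.
move=> ws w0; apply: (ge0_lim ws); apply: nearW => F.
by apply: (@sumr_ge0 C) => k _.
Qed.

(** A finite set whose [h]-sum is close to the supremum leaves little for any finite set disjoint
    from it, so the sums of [w] beyond it are small. Squared norms are controlled because the bounds
    come from orthogonality and from Cauchy-Schwarz. *)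
Lemma sums_to_cauchy (K : choiceType) (V : completeNormedModType C) (w : K -> V)
    (h : K -> R) (c M : R) :
  (forall k, 0 <= h k) -> (forall F : {fset K}, \sum_(k <- F) h k <= M) ->
  (forall F : {fset K}, `|\sum_(k <- F) w k| ^+ 2 <= (c * \sum_(k <- F) h k)%:C) ->
  exists s, sums_to w s.
Proof.
move=> h0 hM hw.
pose E := [set \sum_(k <- F) h k | F in [set: {fset K}]].
have supE : has_sup E.
  split; first by exists (\sum_(k <- fset0) h k), fset0.
  by exists M => _ [F _ <-].
suff : cauchy (partial_sum w @ totally).
  by move=> /cauchy_cvg wc; exists (lim (partial_sum w @ totally)).
apply: cauchy_exP => e e0.
pose r := complex.Re e.
have eE : e = r%:C by rewrite /r RRe_real// gtr0_real.
have r0 : 0 < r by move: e0; rewrite eE ltcR.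
(* This gives [|c| * d <= r ^+ 2]; the summand 1 keeps the quotient meaningful when [c = 0]. *)
pose d := r ^+ 2 / (`|c| + 1).
have d0 : 0 < d by rewrite divr_gt0// ?exprn_gt0// ltr_wpDl.
have [_ [F0 _ <-] F0d] := sup_adherent d0 supE.
exists (partial_sum w F0), F0 => //= F F0F.
rewrite -ball_normE /= distrC !partial_sumE.
have split_sum (U : zmodType) (g : K -> U) :
    \sum_(k <- F) g k - \sum_(k <- F0) g k = \sum_(k <- F `\` F0) g k.
  rewrite (big_fsetID _ (mem F0)) /=.
  have -> : [fset x | x in F & x \in F0] = F0.
    by apply/fsetP => k; rewrite !inE andbC; case: (boolP (k \in F0)) => // /(fsubsetP F0F) ->.
  rewrite addrAC subrr add0r; apply: eq_fbigl => k.
  by rewrite !inE andbC.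
rewrite split_sum -(@ltr_pXn2r _ 2%N) ?nnegrE ?normr_ge0 ?(ltW e0)//.
apply: le_lt_trans (hw _) _; rewrite eE -rmorphXn /= ltcR -split_sum.
have hF : \sum_(k <- F) h k <= sup E by apply: sup_upper_bound => //; exists F.
have hd : \sum_(k <- F) h k - \sum_(k <- F0) h k < d.
  by rewrite ltrBlDr; apply: le_lt_trans hF _; rewrite -ltrBlDl.
have hp : 0 <= \sum_(k <- F) h k - \sum_(k <- F0) h k by rewrite split_sum sumr_ge0.
apply: le_lt_trans (ler_wpM2r hp (ler_norm c)) _.
have [c0|c0] := eqVneq c 0; first by rewrite c0 normr0 mul0r exprn_gt0.
apply: lt_le_trans (_ : `|c| * d <= _); first by rewrite ltr_pM2l// normr_gt0.
by rewrite /d mulrCA ler_piMr ?sqr_ge0// ler_pdivrMr ?mul1r ?lerDl// ltr_wpDl.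
Qed.

End unconditional_sums.

(** * Operators on a Hilbert space *)

Section operators.
Context {R : realType}.
Let C : numFieldType := R[i].

Lemma psd_form_linear_sum (V : lmodType C) (B : V -> V -> C) (K : Type) (s : seq K)
    (c : K -> C) (g : K -> V) x :
  psd_form B -> B x (\sum_(k <- s) c k *: g k) = \sum_(k <- s) c k * B x (g k).
Proof.
move=> [Br _ _].
have B0 : B x 0 = 0.
  have := Br x 1 0 0; rewrite scaler0 addr0 mul1r => /eqP.
  by rewrite -subr_eq subrr => /eqP.
elim: s => [|k s IH]; first by rewrite !big_nil.
by rewrite !big_cons Br IH.
Qed.

(* Cauchy-Schwarz in V^K for the vectors ((c k)^* y)_k and (g k)_k, where y is
   the sum on the left. *)
Lemma psd_form_sum_bound (V : lmodType C) (B : V -> V -> C) (K : Type) (s : seq K)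
    (c : K -> C) (g : K -> V) : psd_form B ->
  B (\sum_(k <- s) c k *: g k) (\sum_(k <- s) c k *: g k) <=
  (\sum_(k <- s) `|c k| ^+ 2) * \sum_(k <- s) B (g k) (g k).
Proof.
move=> HB; set y := \sum_(k <- s) c k *: g k; have [Br Bl B0] := HB.
have BZl x a z : B (a *: z) x = a^* * B z x.
  have := Bl x a z 0; rewrite addr0 => ->.
  have := Bl x 1 0 0; rewrite scaler0 addr0 rmorph1 mul1r => /eqP.
  by rewrite -subr_eq subrr => /eqP <-; rewrite addr0.
have := psd_form_CS (psd_form_sum s HB) (fun k => (c k)^* *: y) g.
have -> : \sum_(k <- s) B ((c k)^* *: y) (g k) = B y y.
  rewrite {3}/y psd_form_linear_sum//; apply: eq_bigr => k _.
  by rewrite BZl conjCK.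
have BZZ k : B ((c k)^* *: y) ((c k)^* *: y) = `|c k| ^+ 2 * B y y.
  have := Br ((c k)^* *: y) (c k)^* y 0; rewrite addr0 => ->.
  have := Br ((c k)^* *: y) 1 0 0; rewrite scaler0 addr0 mul1r => /eqP.
  rewrite -subr_eq subrr => /eqP <-; rewrite addr0 BZl conjCK normCK.
  by rewrite mulrA [_^* * _]mulrC.
under [X in _ <= X * _ -> _]eq_bigr => k _ do rewrite BZZ.
rewrite -mulr_suml ger0_norm//.
have [-> _|q0] := eqVneq (B y y) 0.
  by apply: mulr_ge0; apply: sumr_ge0 => k _; [exact: exprn_ge0|exact: B0].
by rewrite [X in _ <= X * _]mulrC -mulrA expr2 ler_pM2l// lt_neqAle eq_sym q0 B0.
Qed.

Section bounded.
Context {H K : hilbertType R}.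

Lemma additive_bounded_continuous (f : H -> K) (M : C) :
  (forall x y, f (x - y) = f x - f y) -> (forall x, `|f x| <= M * `|x|) ->
  continuous f.
Proof.
move=> fB fM x; apply/cvgrPdist_lt => e e0.
have M0 : 0 < `|M| + 1 by rewrite ltr_wpDl.
have : \forall y \near x, `|x - y| < e / (`|M| + 1).
  by apply: (@cvgr_dist_lt _ _ _ _ _ id) => //; rewrite divr_gt0.
apply: filterS => y xy; rewrite -fB; apply: le_lt_trans (fM _) _.
have [->|n0] := eqVneq `|x - y| 0; first by rewrite mulr0.
have n1 : 0 < `|x - y| by rewrite lt_neqAle eq_sym n0 normr_ge0.
(* The order on [R[i]] is partial, but the assumed bound at the nonzero vector [x - y] forces [M] to
   be nonnegative. *)
have [Mr|Mr] := boolP (M \is Num.real); last first.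
  have := le_trans (normr_ge0 _) (fM (x - y)) => M1.
  have : 0 <= M by rewrite -(pmulr_lge0 _ n1).
  by move=> /ger0_real; rewrite (negPf Mr).
apply: le_lt_trans (_ : `|M| * `|x - y| < _).
  by rewrite ler_wpM2r// real_ler_norm.
apply: le_lt_trans (_ : (`|M| + 1) * `|x - y| < _).
  by rewrite ler_wpM2r// lerDl.
by move: xy; rewrite ltr_pdivlMr// mulrC.
Qed.

End bounded.

Section linear_prop.
Context {U V : lmodType C} (f : U -> V) (fl : linear f).
Lemma linear_propD x y : f (x + y) = f x + f y.
Proof. by have := fl 1 x y; rewrite !scale1r. Qed.
Lemma linear_prop0 : f 0 = 0.
Proof. by apply: (addrI (f 0)); rewrite -linear_propD !addr0. Qed.
Lemma linear_propZ a x : f (a *: x) = a *: f x.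
Proof. by have := fl a x 0; rewrite linear_prop0 !addr0. Qed.
Lemma linear_propN x : f (- x) = - f x.
Proof. by rewrite -scaleN1r linear_propZ scaleN1r. Qed.
Lemma linear_propB x y : f (x - y) = f x - f y.
Proof. by rewrite linear_propD linear_propN. Qed.
Lemma linear_prop_sum (K : Type) (s : seq K) (P : pred K) (g : K -> U) :
  f (\sum_(k <- s | P k) g k) = \sum_(k <- s | P k) f (g k).
Proof. exact: (big_morph f linear_propD linear_prop0). Qed.
End linear_prop.

Lemma linear_comb (U V : lmodType C) (f g : U -> V) (a : C) :
  linear f -> linear g -> linear (fun x => a *: f x + g x).
Proof.
move=> fl gl b x y; rewrite fl gl !scalerDr !scalerA addrACA; congr (_ + _).
by rewrite mulrC.
Qed.

Section psd.
Context {H : hilbertType R}.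
Implicit Types (X Y : H -> H).

Lemma psd_psd_form X : linear X -> (forall x, 0 <= inner x (X x)) ->
  psd_form (fun u v => inner u (X v) : C).
Proof.
move=> lX X0; split => // [x a y z|x a y z].
  by rewrite lX innerDr innerZr.
by rewrite innerDl innerZl.
Qed.

Lemma bounded_op_lin X Y (a : C) : bounded_op X -> bounded_op Y ->
  bounded_op (a *: X + Y).
Proof.
move=> [lX cX] [lY cY]; split; first exact: linear_comb.
move=> x; apply: cvgD; last exact: cY.
by apply: cvgZl_tmp; exact: cX.
Qed.

Lemma bounded_op0 : bounded_op (0 : H -> H).
Proof.
split; first by move=> a x y; rewrite /= scaler0 addr0.
by move=> x; exact: cvg_cst.
Qed.

End psd.

Section orthonormal.
Context {H : hilbertType R} {K : choiceType}.
Implicit Types (f g : K -> H) (s : seq K).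

Definition orthonormal_family f := forall i j, inner (f i) (f j) = (i == j)%:R :> C.

Lemma orthonormal_inner f s (c : K -> C) k : orthonormal_family f -> uniq s ->
  inner (f k) (\sum_(i <- s) c i *: f i) = (if k \in s then c k else 0) :> C.
Proof.
move=> of_ us; rewrite inner_sumr.
under eq_bigr => i _ do rewrite innerZr of_.
case: ifPn => ks; last first.
  rewrite big_seq big1// => i si; case: eqVneq => [E|]; last by rewrite mulr0.
  by rewrite -E (negPf (_ : k \notin s)) in si.
rewrite (bigD1_seq k)//= eqxx mulr1 big1 ?addr0// => i ik.
by rewrite eq_sym (negPf ik) mulr0.
Qed.

Lemma orthonormal_norm f s (c : K -> C) : orthonormal_family f -> uniq s ->
  `|\sum_(i <- s) c i *: f i| ^+ 2 = \sum_(i <- s) `|c i| ^+ 2.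
Proof.
move=> of_ us; rewrite -inner_norm inner_suml big_seq [RHS]big_seq.
apply: eq_bigr => i si; rewrite innerZl orthonormal_inner// si.
by rewrite normCK mulrC.
Qed.

Lemma bessel f s x : orthonormal_family f -> uniq s ->
  \sum_(k <- s) `|inner (f k) x| ^+ 2 <= `|x| ^+ 2.
Proof.
move=> of_ us; pose y := \sum_(k <- s) inner (f k) x *: f k.
have yx : inner y x = `|y| ^+ 2.
  rewrite orthonormal_norm// inner_suml; apply: eq_bigr => k _.
  by rewrite innerZl normCK mulrC.
have xy : inner x y = `|y| ^+ 2.
  by rewrite inner_conj yx geC0_conj// exprn_ge0.
have := inner_ge0 (x - y).
rewrite innerBl !innerBr yx xy !inner_norm subrr subr0 subr_ge0.
by rewrite orthonormal_norm.
Qed.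

End orthonormal.

(** The operator is the sum of the |g_k><f_k|; Bessel's inequality yields both convergence and norm
    at most 1. It serves twice: from the product basis to itself it gives the basis expansion, and
    from one column of that basis to another it gives 1 (x) |i><j|. *)
Lemma shift_op_exists (H : hilbertType R) (K : choiceType) (f g : K -> H) :
  orthonormal_family f -> orthonormal_family g ->
  exists2 Y : H -> H, bounded_op Y &
    forall x, sums_to (fun k => inner (f k) x *: g k) (Y x).
Proof.
move=> of_ og.
have ex x : exists y, sums_to (fun k => inner (f k) x *: g k) y.
  have RC (z : H) : (complex.Re (`|z| ^+ 2))%:C = `|z| ^+ 2.
    by rewrite RRe_real// ger0_real// exprn_ge0.
  have RCc (z : C) : (complex.Re (`|z| ^+ 2))%:C = `|z| ^+ 2.
    by rewrite RRe_real// ger0_real// exprn_ge0.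
  have RS (F : seq K) : (\sum_(k <- F) complex.Re (`|inner (f k) x| ^+ 2))%:C
      = \sum_(k <- F) `|inner (f k) x| ^+ 2.
    by rewrite rmorph_sum; apply: eq_bigr => k _; exact: RCc.
  apply: (@sums_to_cauchy _ _ _ _ (fun k => complex.Re (`|inner (f k) x| ^+ 2)) 1
    (complex.Re (`|x| ^+ 2))) => [k|F|F].
  - by rewrite -lecR RCc exprn_ge0.
  - by rewrite -lecR RS RC; apply: bessel.
  - by rewrite mul1r RS orthonormal_norm.
have [Y HY] := choice ex; exists Y => //.
have Yl : linear Y.
  move=> a x y; rewrite -(sums_toE (HY _)) -(sums_toE (sums_to_lin (a := a) (HY x) (HY y))).
  congr (summability.sum _); apply/funext => k.
  by rewrite innerDr innerZr scalerDl scalerA.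
split=> //; apply: (@additive_bounded_continuous _ _ _ 1) => [x y|x].
  exact: linear_propB.
rewrite mul1r -(@ler_pXn2r _ 2%N) ?nnegrE// -subr_ge0.
apply: (@ge0_lim _ _ summability.totally _ (fun F : {fset K} => `|x| ^+ 2 -
    `|summability.partial_sum (fun k => inner (f k) x *: g k) F| ^+ 2)).
  by apply: cvgB; [exact: cvg_cst|apply: cvg_norm_sq; exact: HY].
apply: nearW => F; rewrite partial_sumE subr_ge0 orthonormal_norm//.
exact: bessel.
Qed.

End operators.

(** * The tensor product basis *)

Section tensor.
Context {R : realType} {I J : choiceType} (AB : bipartite R I J).
Let C : numFieldType := R[i].
Local Notation op := (AB -> AB).
Local Notation e := (basisAB AB).
Local Notation eB := (basisB AB).

Lemma linear_ext_onb (H : hilbertType R) (K : choiceType) (b : K -> H)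
    (V : normedModType C) (f g : H -> V) : orthonormal_basis b ->
  linear f -> linear g -> continuous f -> continuous g ->
  (forall k, f (b k) = g (b k)) -> f = g.
Proof.
move=> [_ db] fl gl cf cg fg; apply: eq_dense db cf cg _ => _ [s [c ->]].
rewrite !linear_prop_sum//; apply: eq_bigr => k _.
by rewrite !linear_propZ// fg.
Qed.

Lemma tens_linl b : linear ((@tens _ _ _ AB)^~ b).
Proof. exact: tens_linear_l. Qed.

Lemma tens_linr a : linear (@tens _ _ _ AB a).
Proof. exact: tens_linear_r. Qed.

Lemma norm_tens (a : alice AB) (b : bob AB) : `|tens a b| = `|a| * `|b|.
Proof.
apply: (@pexpIrn _ 2%N) => //; rewrite ?nnegrE ?mulr_ge0//.
by rewrite exprMn -!inner_norm tens_inner.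
Qed.

Lemma tens_continuousl b : continuous ((@tens _ _ _ AB)^~ b).
Proof.
apply: (@additive_bounded_continuous _ _ _ _ `|b|) => [x y|x].
  by have := linear_propB (tens_linl b).
by rewrite norm_tens mulrC.
Qed.

Lemma tens_continuousr a : continuous (@tens _ _ _ AB a).
Proof.
apply: (@additive_bounded_continuous R (bob AB) AB (tens a) `|a|) => [x y|x].
  by have := linear_propB (tens_linr a).
by rewrite norm_tens.
Qed.

(** Stated for additive maps so as to cover the antilinear first argument of the inner product. *)
Lemma additive_ext_tens (V : normedModType C) (f g : AB -> V) :
  (forall x y, f (x + y) = f x + f y) -> (forall x y, g (x + y) = g x + g y) ->
  continuous f -> continuous g ->
  (forall a b, f (tens a b) = g (tens a b)) -> f = g.
Proof.
move=> fD gD cf cg fg; apply: eq_dense (@tens_dense _ _ _ AB) cf cg _ => _ [s ->].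
have f0 : f 0 = 0 by apply: (addrI (f 0)); rewrite -fD !addr0.
have g0 : g 0 = 0 by apply: (addrI (g 0)); rewrite -gD !addr0.
rewrite (big_morph f fD f0) (big_morph g gD g0).
by apply: eq_bigr => p _; exact: fg.
Qed.

(** Density of the span of the product basis is not a field of [bipartite]. It is replaced by
    density of the simple tensors, followed by density of the basis span in each factor
    separately. *)
Lemma linear_ext_basisAB (V : normedModType C) (f g : AB -> V) :
  linear f -> linear g -> continuous f -> continuous g ->
  (forall p, f (e p) = g (e p)) -> f = g.
Proof.
move=> fl gl cf cg fg.
have tl b (h : AB -> V) : linear h -> linear (fun a : alice AB => h (tens a b)).
  by move=> hl a x y; rewrite tens_linl hl.
have tr a (h : AB -> V) : linear h -> linear (fun b : bob AB => h (tens a b)).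
  by move=> hl c x y; rewrite tens_linr hl.
have cl b (h : AB -> V) : continuous h -> continuous (fun a : alice AB => h (tens a b)).
  by move=> ch x; apply: continuous_comp; [exact: tens_continuousl|exact: ch].
have cr a (h : AB -> V) : continuous h -> continuous (fun b : bob AB => h (tens a b)).
  by move=> ch x; apply: continuous_comp; [exact: tens_continuousr|exact: ch].
apply: additive_ext_tens => // [x y|x y|a b].
- exact: linear_propD.
- exact: linear_propD.
suff /(congr1 (@^~ b)) : (fun b => f (tens a b)) = (fun b => g (tens a b)) by [].
apply: linear_ext_onb (basisB_onb AB) (tr _ _ fl) (tr _ _ gl) (cr _ _ cf) (cr _ _ cg) _ => j.
suff /(congr1 (@^~ a)) : (fun a => f (tens a (eB j))) = (fun a => g (tens a (eB j))) by [].
apply: linear_ext_onb (basisA_onb AB) (tl _ _ fl) (tl _ _ gl) (cl _ _ cf) (cl _ _ cg) _ => i.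
exact: (fg (i, j)).
Qed.

Lemma inner_basisA i j : inner (basisA AB i) (basisA AB j) = (i == j)%:R.
Proof. by have [->] := basisA_onb AB. Qed.

Lemma inner_basisB i j : inner (eB i) (eB j) = (i == j)%:R.
Proof. by have [->] := basisB_onb AB. Qed.

Lemma inner_basisAB p q : inner (e p) (e q) = (p == q)%:R.
Proof.
case: p q => [i j] [k l]; rewrite /basisAB /= tens_inner inner_basisA inner_basisB.
by rewrite -natrM mulnb xpair_eqE.
Qed.

Lemma basisAB_orthonormal : orthonormal_family e.
Proof. exact: inner_basisAB. Qed.

(** The series defines a bounded operator that fixes every [e p], hence the identity. *)
Lemma basisAB_expand x : sums_to (fun p => inner (e p) x *: e p) x.
Proof.
have [Y [Yl cY] HY] := shift_op_exists basisAB_orthonormal basisAB_orthonormal.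
suff YE : Y = id by move: (HY x); rewrite YE.
apply: linear_ext_basisAB => // [y|p]; first exact: cvg_id.
rewrite -(sums_toE (HY (e p))).
apply: etrans (sums_toE (sums_to1 (k := p) _)) _; last first.
  by rewrite inner_basisAB eqxx scale1r.
by move=> q qp; rewrite inner_basisAB (negPf qp) scale0r.
Qed.

Lemma tens_op_unique S T (Y : op) : bounded_op Y ->
  (forall a b, Y (tens a b) = tens (S a) (T b)) -> tens_op S T = Y.
Proof.
move=> bY YE; rewrite /tens_op.
case: xgetP => [Z _ [[Zl cZ] ZE]|/(_ Y)[]//].
have [Yl cY] := bY.
apply: additive_ext_tens => // [x y|x y|a b]; [exact: linear_propD..|].
by rewrite ZE YE.
Qed.

(* The operator 1 (x) |i><j|. *)
Definition slice i j : op := tens_op id (ketbra (eB i) (eB j)).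

(** The operator shifts column [j] of the product basis to column [i]. For fixed [b] both sides are
    linear and continuous in [a], so the formula is tested on Alice's basis only. *)
Lemma slice_spec i j : bounded_op (slice i j) /\
  forall a b, slice i j (tens a b) = inner (eB j) b *: tens a (eB i).
Proof.
have ons k : orthonormal_family (fun m => e (m, k)).
  by move=> m n; rewrite inner_basisAB xpair_eqE eqxx andbT.
have [Y bY HY] := shift_op_exists (ons j) (ons i).
suff YE a b : Y (tens a b) = inner (eB j) b *: tens a (eB i).
  suff -> : slice i j = Y by [].
  by apply: tens_op_unique => // a b; rewrite YE /ketbra (linear_propZ (tens_linr a)).
have [Yl cY] := bY.
suff /(congr1 (@^~ a)) : (fun a => Y (tens a b)) =
  (fun a => inner (eB j) b *: tens a (eB i)) by [].
apply: linear_ext_onb (basisA_onb AB) _ _ _ _ _.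
- by move=> c x y; rewrite tens_linl Yl.
- by move=> c x y; rewrite tens_linl scalerDr !scalerA mulrC.
- by move=> x; apply: continuous_comp; [exact: tens_continuousl|exact: cY].
- by move=> x; apply: cvgZl_tmp; exact: tens_continuousl.
move=> n; rewrite -(sums_toE (HY _)).
apply: etrans (sums_toE (sums_to1 (k := n) _)) _ => [m mn|]; last first.
  by rewrite /basisAB /= tens_inner inner_basisA eqxx mul1r.
by rewrite /basisAB /= tens_inner inner_basisA (negPf mn) mul0r scale0r.
Qed.

Lemma slice_bounded i j : bounded_op (slice i j).
Proof. by case: (slice_spec i j). Qed.

Lemma slice_linear i j : linear (slice i j).
Proof. by case: (slice_bounded i j). Qed.

Lemma slice_continuous i j : continuous (slice i j).
Proof. by case: (slice_bounded i j). Qed.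

Lemma slice_tens i j a b : slice i j (tens a b) = inner (eB j) b *: tens a (eB i).
Proof. by case: (slice_spec i j). Qed.

Lemma slice_basisAB i j p :
  slice i j (e p) = if p.2 == j then e (p.1, i) else 0.
Proof.
rewrite slice_tens inner_basisB eq_sym; case: eqP => _; last by rewrite scale0r.
by rewrite scale1r.
Qed.

Lemma inner_slice i j u v : inner u (slice i j v) = inner (slice j i u) v.
Proof.
have cinr (f : op) w : continuous f -> continuous (fun x => inner w (f x) : C^o).
  by move=> cf x; apply: inner_cvg; [exact: cvg_cst|exact: cf].
have cinl (f : op) w : continuous f -> continuous (fun x => inner (f x) w : C^o).
  by move=> cf x; apply: inner_cvg; [exact: cf|exact: cvg_cst].
have cid : continuous (id : op) by move=> x; exact: cvg_id.
have sD := linear_propD (slice_linear _ _).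
suff /(congr1 (@^~ v)) : (fun v => inner u (slice i j v) : C^o) =
   (fun v => inner (slice j i u) v) by [].
apply: additive_ext_tens => [x y|x y|||a b]; rewrite ?sD ?innerDr//.
- exact/cinr/slice_continuous.
- exact: (cinr id).
suff /(congr1 (@^~ u)) : (fun u => inner u (slice i j (tens a b)) : C^o) =
   (fun u => inner (slice j i u) (tens a b)) by [].
apply: additive_ext_tens => [x y|x y|||a' b']; rewrite ?sD ?innerDl//.
- exact: (cinl id).
- exact/cinl/slice_continuous.
rewrite !slice_tens innerZr innerZl !tens_inner -inner_conj.
by rewrite mulrC -mulrA mulrCA.
Qed.

End tensor.

(** * Trace and partial transpose *)

Section trace_and_partial_transpose.
Context {R : realType}.
Let C : numFieldType := R[i].

Lemma ler_sum_sub (K : eqType) (s s' : seq K) (f : K -> C) :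
  uniq s -> {subset s <= s'} -> (forall k, 0 <= f k) ->
  \sum_(k <- s) f k <= \sum_(k <- s') f k.
Proof.
move=> + + f0; elim: s s' => [|k s IH] s'; first by rewrite big_nil sumr_ge0.
rewrite /= => /andP[ks us] ss'.
have ks' : k \in s' by apply: ss'; rewrite mem_head.
rewrite (perm_big _ (perm_to_rem ks')) /= !big_cons lerD2l; apply: IH => // x xs.
have := perm_mem (perm_to_rem ks') x; rewrite ss' ?inE ?xs ?orbT//.
by case: eqVneq ks => [<-|//]; rewrite xs.
Qed.

Lemma sums_to_nonneg (K : choiceType) (t : K -> C) (tau : R) :
  (forall k, 0 <= t k) ->
  (forall F : {fset K}, \sum_(k <- F) t k <= tau%:C) ->
  exists s : C^o, sums_to (t : K -> C^o) s.
Proof.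
move=> t0 tF.
have RC k : (complex.Re (t k))%:C = t k by rewrite RRe_real// ger0_real.
have RS (F : seq K) : (\sum_(k <- F) complex.Re (t k))%:C = \sum_(k <- F) t k.
  by rewrite rmorph_sum; apply: eq_bigr => k _; exact: RC.
pose E := [set \sum_(k <- F) complex.Re (t k) | F in [set: {fset K}]].
have supE : has_sup E.
  split; first by exists (\sum_(k <- fset0) complex.Re (t k)), fset0.
  by exists tau => _ [F _ <-]; rewrite -lecR RS.
exists (sup E)%:C; apply/(@cvgrPdist_lt C C^o) => e e0.
have eE : e = (complex.Re e)%:C by rewrite RRe_real// gtr0_real.
have r0 : 0 < complex.Re e by move: e0; rewrite eE ltcR.
have [_ [F0 _ <-] F0d] := sup_adherent r0 supE.
exists F0 => //= F F0F; rewrite partial_sumE -RS.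
have hF : \sum_(k <- F) complex.Re (t k) <= sup E by apply: sup_upper_bound => //; exists F.
have h0 : \sum_(k <- F0) t k <= \sum_(k <- F) t k.
  by apply: ler_sum_sub => //; exact/fsubsetP.
rewrite -rmorphB /= ger0_norm ?ler0c ?subr_ge0// eE ltcR ltrBlDl -ltrBlDr.
by apply: lt_le_trans F0d _; rewrite -lecR !RS.
Qed.

Context {I J : choiceType} (AB : bipartite R I J).
Local Notation op := (AB -> AB).
Local Notation e := (basisAB AB).
Local Notation slice := (@slice R I J AB).
Implicit Types X Y P : op.

Definition diag X (p : I * J) : C := inner (e p) (X (e p)).

(** Finite partial sums replace the extended real [esum], so that the bound applies directly in
    inequalities between complex numbers. *)
Definition trace_bound X (tau : R) :=
  forall s : seq (I * J), uniq s -> \sum_(p <- s) diag X p <= tau%:C.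

Lemma psd_diag_ge0 P p : psd P -> 0 <= diag P p.
Proof. by case=> _; exact. Qed.

Lemma psd_finite_trace_bound P : psd_finite_trace P -> exists tau, trace_bound P tau.
Proof.
move=> [pP fP].
have RC p : (complex.Re (diag P p))%:C = diag P p.
  by rewrite RRe_real// ger0_real// psd_diag_ge0.
set S := (X in (X < _)%E) in fP.
have S0 : (0 <= S)%E.
  by apply: esum_ge0 => p _; rewrite lee_fin -ler0c RC psd_diag_ge0.
have Sf : S \is a fin_num by rewrite ge0_fin_numE.
exists (fine S) => s us.
rewrite -(eq_bigr _ (fun p _ => RC p)) -rmorph_sum lecR -lee_fin fineK//.
apply: esum_ge; exists [set` s]; first by split => //; exact: finite_seq.
by rewrite -fsbig_seq// sumEFin.
Qed.

Lemma trace_bound_finite P tau : psd P -> trace_bound P tau -> psd_finite_trace P.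
Proof.
move=> pP tP; split=> //; apply: le_lt_trans (ltry tau).
apply: ge_ereal_sup => _ [X [finX _] <-].
rewrite fsbig_finite//= sumEFin lee_fin -lecR rmorph_sum.
have RC p : (complex.Re (diag P p))%:C = diag P p.
  by rewrite RRe_real// ger0_real// psd_diag_ge0.
by rewrite (eq_bigr _ (fun p _ => RC p)); exact: (tP (fset_set X) (fset_uniq _)).
Qed.

Lemma trace_class_psd P : psd_finite_trace P -> trace_class P.
Proof.
by move=> fP; exists 1, (fun=> 1), (fun=> P); split=> //; rewrite big_ord1 scale1r.
Qed.

Lemma trace_class0 : trace_class (0 : op).
Proof. by exists 0, (fun=> 0), (fun=> 0); split=> [[]//|]; rewrite big_ord0. Qed.

Lemma trace_class_lin (a : C) X Y :
  trace_class X -> trace_class Y -> trace_class (a *: X + Y).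
Proof.
move=> [n [c [P [fP ->]]]] [m [d [Q [fQ ->]]]].
exists (n + m)%N,
  (fun k : 'I_(n + m) =>
     match fintype.split k with inl i => a * c i | inr j => d j end),
  (fun k : 'I_(n + m) => match fintype.split k with inl i => P i | inr j => Q j end); split.
  by move=> k; case: (fintype.split k).
rewrite big_split_ord /= scaler_sumr; congr (_ + _); apply: eq_bigr => k _.
  by rewrite -[lshift _ _]/(unsplit (inl _)) unsplitK scalerA.
by rewrite -[rshift _ _]/(unsplit (inr _)) unsplitK.
Qed.

Lemma trace_classZ (a : C) X : trace_class X -> trace_class (a *: X).
Proof.
move=> tX; rewrite -[_ *: _]addr0.
by apply: trace_class_lin => //; exact: trace_class0.
Qed.

(** Positive operators of finite trace span the trace class. Convergence of a series that depends
    linearly on [X] is stable under linear combinations, so this induction reduces it to positive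
    operators with a trace bound. *)
Lemma trace_class_ind (Q : op -> Prop) : Q 0 ->
  (forall (a : C) X Y, Q X -> Q Y -> Q (a *: X + Y)) ->
  (forall P tau, psd P -> trace_bound P tau -> Q P) ->
  forall X, trace_class X -> Q X.
Proof.
move=> Q0 QD QP _ [n [c [P [fP ->]]]]; elim/big_ind: _ => // [X Y QX QY|k _].
  by rewrite -[X]scale1r; exact: QD.
rewrite -[_ *: _]addr0; apply: QD => //.
by have [tau] := psd_finite_trace_bound (fP k); apply: QP; case: (fP k).
Qed.

Lemma trace_class_bounded X : trace_class X -> bounded_op X.
Proof.
move: X; apply: trace_class_ind => [|a X Y|P tau [] //]; first exact: bounded_op0.
exact: bounded_op_lin.
Qed.

Lemma trace_sums X : trace_class X -> sums_to (diag X : _ -> C^o) (trace X).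
Proof.
move=> tX; suff [s h] : exists s : C^o, sums_to (diag X : _ -> C^o) s.
  by have := sums_toE h; rewrite /trace => ->.
move: X tX; apply: trace_class_ind => [|a X Y [s hs] [t ht]|P tau pP tP].
- exists 0; apply: sums_to_eq _ sums_to_zero => p.
  by rewrite /diag inner0r.
- exists (a *: s + t); apply: sums_to_eq _ (sums_to_lin hs ht) => p.
  by rewrite /diag innerDr innerZr.
- apply: (@sums_to_nonneg _ _ tau) => [p|F]; first exact: psd_diag_ge0.
  exact: tP (fset_uniq F).
Qed.

Lemma trace_lin (a : C) X Y : trace_class X -> trace_class Y ->
  trace (a *: X + Y) = a * trace X + trace Y.
Proof.
move=> tX tY.
apply: etrans (esym (sums_toE (trace_sums (trace_class_lin a tX tY)))) _.
apply: sums_toE; apply: sums_to_eq _ (sums_to_lin (trace_sums tX) (trace_sums tY)) => p.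
by rewrite /diag innerDr innerZr.
Qed.

Lemma traceZ (a : C) X : trace_class X -> trace (a *: X) = a * trace X.
Proof.
move=> tX; have := trace_lin (a - 1) tX tX.
by rewrite -{2}[X]scale1r -scalerDl subrK mulrBl mul1r subrK.
Qed.

(* Both sides are continuous in x, so it suffices to bound the finite partial
   sums of the basis expansion of x. *)
Lemma slice_energy X tau x (F : seq (J * J)) :
  psd X -> trace_bound X tau -> uniq F ->
  \sum_(p <- F) inner (slice p.1 p.2 x) (X (slice p.1 p.2 x)) <= tau%:C * `|x| ^+ 2.
Proof.
move=> pX tX uF; have [[Xl cX] X0] := pX.
have formX := psd_psd_form Xl X0.
have tau0 : 0 <= tau%:C :> C by have := tX [::] isT; rewrite big_nil.
have fin (G : seq (I * J)) (c : I * J -> C) : uniq G ->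
    let y := \sum_(q <- G) c q *: e q in
    is_true (\sum_(p <- F) inner (slice p.1 p.2 y) (X (slice p.1 p.2 y)) <=
      tau%:C * \sum_(q <- G) `|c q| ^+ 2).
  move=> uG y.
  pose M := undup (map fst G).
  pose S i := \sum_(m <- M) diag X (m, i).
  pose r j := \sum_(q <- G | q.2 == j) `|c q| ^+ 2.
  have S0 i : 0 <= S i by apply: sumr_ge0 => m _; exact: psd_diag_ge0.
  have r0 j : 0 <= r j by apply: sumr_ge0 => q _; exact: exprn_ge0.
  (* Slicing keeps the coefficients of [y] in column [j] and moves them to column [i].
     Cauchy-Schwarz separates their weight [r j] from the diagonal entries of [X] in column [i]. *)
  have step i j : inner (slice i j y) (X (slice i j y)) <= r j * S i.
    have -> : slice i j y = \sum_(q <- [seq q <- G | q.2 == j]) c q *: e (q.1, i).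
      rewrite /y (linear_prop_sum (slice_linear _ _)) big_filter [RHS]big_mkcond.
      apply: eq_bigr => q _; rewrite (linear_propZ (slice_linear _ _)).
      by rewrite slice_basisAB; case: eqP => // _; rewrite scaler0.
    apply: le_trans (psd_form_sum_bound _ _ _ formX) _.
    rewrite big_filter; apply: ler_wpM2l; first exact: r0.
    set T := (X in X <= _).
    have -> : T = \sum_(m <- map fst [seq q <- G | q.2 == j]) diag X (m, i) by rewrite big_map.
    apply: ler_sum_sub => [|m|m]; last exact: psd_diag_ge0.
      rewrite map_inj_in_uniq ?filter_uniq// => -[a b] [a' b'].
      by rewrite !mem_filter /= => /andP[/eqP -> _] /andP[/eqP -> _] ->.
    by rewrite mem_undup => /mapP[q]; rewrite mem_filter => /andP[_ qG] ->; exact: map_f.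
  pose F1 := undup (map fst F); pose F2 := undup (map snd F).
  apply: le_trans (ler_sum _ (fun p _ => step p.1 p.2)) _.
  (* Enlarging [F] to a rectangle turns the sum of the [r j * S i] into a product of two sums,
     bounded by the total weight of the coefficients and by the trace of [X]. *)
  apply: le_trans (_ : \sum_(p <- [seq (i, j) | i <- F1, j <- F2]) r p.2 * S p.1 <= _).
    apply: ler_sum_sub => // [[i j] ijF|p]; last exact: mulr_ge0.
    apply/allpairsP; exists (i, j); rewrite !mem_undup.
    by split=> //; apply/mapP; exists (i, j).
  rewrite big_allpairs /=.
  under eq_bigr => i _ do rewrite -mulr_suml.
  rewrite -mulr_sumr mulrC; apply: ler_pM.
  - exact: sumr_ge0.
  - exact: sumr_ge0.
  - rewrite /S exchange_big /=; set T := (X in X <= _).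
    have -> : T = \sum_(q <- [seq (m, i) | m <- M, i <- F1]) diag X q by rewrite big_allpairs.
    by apply: tX; apply: allpairs_uniq => [||[? ?] [? ?]]; rewrite ?undup_uniq.
  - rewrite /r; under [X in X <= _]eq_bigr => j _ do rewrite big_mkcond /=.
    rewrite exchange_big /=; apply: ler_sum => q _.
    have [qF|qF] := boolP (q.2 \in F2).
      rewrite (bigD1_seq q.2) ?undup_uniq//= eqxx big1 ?addr0// => j.
      by rewrite eq_sym => /negPf ->.
    rewrite big_seq big1 ?exprn_ge0// => j jF.
    by case: eqP => // E; rewrite E jF in qF.
rewrite -subr_ge0.
apply: (@ge0_lim _ _ summability.totally _ (fun G : {fset I * J} =>
   let y := summability.partial_sum (fun q => inner (e q) x *: e q) G in
   tau%:C * `|x| ^+ 2 - \sum_(p <- F) inner (slice p.1 p.2 y) (X (slice p.1 p.2 y)))).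
  apply: cvgB; first exact: cvg_cst.
  apply: (@cvg_sum_seq R _ _ _ _ C^o) => p.
  have h := @basisAB_expand _ _ _ AB x.
  have h1 := cvg_comp _ _ h (@slice_continuous _ _ _ AB p.1 p.2 x).
  have h2 := cvg_comp _ _ h1 (cX (slice p.1 p.2 x)).
  exact: inner_cvg h1 h2.
apply: nearW => G; rewrite /= partial_sumE subr_ge0.
apply: le_trans (fin G (fun q => inner (e q) x) (fset_uniq _)) _.
by rewrite ler_wpM2l//; apply: bessel => //; exact: basisAB_orthonormal.
Qed.

Definition transpose_term X x (p : J * J) : AB := slice p.1 p.2 (X (slice p.1 p.2 x)).

Lemma psd_transpose_sums P tau x : psd P -> trace_bound P tau ->
  exists y, sums_to (transpose_term P x) y.
Proof.
move=> pP tP; have [[Pl cP] P0] := pP.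
pose h (p : J * J) := complex.Re (inner (slice p.1 p.2 x) (P (slice p.1 p.2 x))).
have hC p : (h p)%:C = inner (slice p.1 p.2 x) (P (slice p.1 p.2 x)).
  by rewrite RRe_real// ger0_real.
have hS (F : seq (J * J)) : (\sum_(p <- F) h p)%:C =
    \sum_(p <- F) inner (slice p.1 p.2 x) (P (slice p.1 p.2 x)).
  by rewrite rmorph_sum; apply: eq_bigr => p _; exact: hC.
apply: (@sums_to_cauchy _ _ _ _ h tau (tau * complex.Re (`|x| ^+ 2))).
- by move=> p; rewrite -lecR hC.
- move=> F; rewrite -lecR hS rmorphM /= RRe_real ?ger0_real ?exprn_ge0//.
  exact: (slice_energy x pP tP (fset_uniq F)).
move=> F; set u := \sum_(p <- F) _.
rewrite rmorphM /= hS.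
have formP := psd_form_sum F (psd_psd_form Pl P0).
(* The adjoint of 1 (x) |i><j| is 1 (x) |j><i|, so in the pairing of [u] with itself the outer slice
   of each term moves onto the left copy of [u]. *)
have := psd_form_CS formP (fun p => slice p.2 p.1 u) (fun p => slice p.1 p.2 x).
have -> : \sum_(p <- F) inner (slice p.2 p.1 u) (P (slice p.1 p.2 x)) = `|u| ^+ 2.
  by rewrite -inner_norm {2}/u inner_sumr; apply: eq_bigr => p _; rewrite inner_slice.
set T := \sum_(p <- F) inner (slice p.1 p.2 x) _.
have T0 : 0 <= T by apply: sumr_ge0.
have ub : \sum_(p <- F) inner (slice p.2 p.1 u) (P (slice p.2 p.1 u)) <= tau%:C * `|u| ^+ 2.
  have := slice_energy u pP tP (F := [seq (p.2, p.1) | p <- F]).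
  rewrite big_map; apply; rewrite map_inj_uniq ?fset_uniq//.
  by move=> [? ?] [? ?] [-> ->].
rewrite ger0_norm ?exprn_ge0// => /le_trans /(_ (ler_wpM2r T0 ub)).
(* The inequality now reads |u|^4 <= tau |u|^2 T, and one factor |u|^2 is cancelled. *)
have [->|u0] := eqVneq (`|u| ^+ 2) 0.
  move=> _; rewrite mulr_ge0//.
  by have := tP [::] isT; rewrite big_nil.
have u1 : 0 < `|u| ^+ 2 by rewrite lt_neqAle eq_sym u0 exprn_ge0.
by rewrite -mulrA mulrCA [X in X <= _]expr2 ler_pM2l.
Qed.

Lemma ptranspose_sums X x : trace_class X ->
  sums_to (transpose_term X x) (ptranspose X x).
Proof.
move=> tX; suff [y h] : exists y, sums_to (transpose_term X x) y.
  by have := sums_toE h; rewrite /ptranspose => ->.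
move: X tX; apply: trace_class_ind => [|a X Y [s hs] [t ht]|P tau pP tP].
- exists 0; apply: sums_to_eq _ sums_to_zero => p.
  by rewrite /transpose_term (linear_prop0 (slice_linear _ _)).
- exists (a *: s + t); apply: sums_to_eq _ (sums_to_lin hs ht) => p.
  by rewrite /transpose_term slice_linear.
- exact: psd_transpose_sums pP tP.
Qed.

Lemma ptranspose_lin (a : C) X Y : trace_class X -> trace_class Y ->
  ptranspose (a *: X + Y) = a *: ptranspose X + ptranspose Y.
Proof.
move=> tX tY; apply/funext => x.
apply: etrans (esym (sums_toE (ptranspose_sums (trace_class_lin a tX tY)))) _.
apply: sums_toE.
apply: sums_to_eq _ (sums_to_lin (ptranspose_sums tX) (ptranspose_sums tY)) => p.
by rewrite /transpose_term slice_linear.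
Qed.

Lemma ptransposeZ (a : C) X : trace_class X -> ptranspose (a *: X) = a *: ptranspose X.
Proof.
move=> tX; have := ptranspose_lin (a - 1) tX tX.
by rewrite -{2}[X]scale1r -scalerDl subrK scalerBl scale1r subrK.
Qed.

Lemma ptranspose_linear X : trace_class X -> linear (ptranspose X).
Proof.
move=> tX a x y; have [Xl _] := trace_class_bounded tX.
apply: etrans (esym (sums_toE (ptranspose_sums tX))) _.
apply: sums_toE.
apply: sums_to_eq _ (sums_to_lin (ptranspose_sums tX) (ptranspose_sums tX)) => p.
by rewrite /transpose_term slice_linear Xl slice_linear.
Qed.

Lemma inner_ptranspose X p x : trace_class X ->
  sums_to (fun q => inner (slice q.2 q.1 (e p)) (X (slice q.1 q.2 x)) : C^o)
    (inner (e p) (ptranspose X x)).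
Proof.
move=> tX; apply: sums_to_eq _
  (sums_to_cont (f := inner (e p) : _ -> C^o) _ _ (ptranspose_sums tX)).
- by move=> q; rewrite /= inner_slice.
- exact: innerDr.
- by move=> y; apply: inner_cvg; [exact: cvg_cst|exact: cvg_id].
Qed.

(** At [e p] only the slice |j><j| with [j = p.2] survives in the series. This is what lets
    inequalities between partial transposes speak about traces. *)
Lemma diag_ptranspose X p : trace_class X -> diag (ptranspose X) p = diag X p.
Proof.
move=> tX; rewrite /diag -(sums_toE (inner_ptranspose tX)).
apply: etrans (sums_toE (sums_to1 (k := (p.2, p.2)) _)) _ => [[i j]|].
  have X0 := linear_prop0 (trace_class_bounded tX).1.
  rewrite !slice_basisAB /= xpair_eqE.
  case: (eqVneq p.2 i) => [<-|_]; last by rewrite inner0l.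
  case: (eqVneq p.2 j) => [<-|_]; last by rewrite X0 inner0r.
  by [].
by rewrite !slice_basisAB eqxx -surjective_pairing.
Qed.

End trace_and_partial_transpose.

(** * Converse *)

Section finite_dimension.
Context {R : realType}.
Let C : numFieldType := R[i].

Lemma sums_to_fin (K : finType) (V : normedModType C) (w : K -> V) :
  sums_to w (\sum_k w k).
Proof.
pose F := [fset k | k in K]%fset.
have mF k : k \in F by rewrite !inE.
have -> : \sum_k w k = \sum_(k <- F) w k.
  apply: perm_big; apply: uniq_perm => [||k]; first exact: index_enum_uniq.
    exact: fset_uniq.
  by rewrite mem_index_enum mF.
by apply: sums_to_fset => k; rewrite mF.
Qed.

(** Sums over [basisAB] are indexed by a product of choice types rather than by the finite product
    type; the two are convertible, which transfers the finite case. *)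
Lemma sums_to_pair (d : nat) (V : normedModType C) (w : 'I_d * 'I_d -> V) :
  @sums_to R (('I_d : choiceType) * ('I_d : choiceType))%type V w (\sum_p w p).
Proof. exact: (sums_to_fin (w := w)). Qed.

Lemma positive_of_cp (H K : hilbertType R) (D : set (H -> H))
    (N : (H -> H) -> (K -> K)) (P : H -> H) :
  completely_positive D N -> D P -> (forall x, 0 <= inner x (P x)) ->
  forall x, 0 <= inner x (N P x).
Proof.
move=> cpN DP P0 x.
have := cpN 1 (fun _ _ => P) (fun _ _ => DP) _ (fun=> x).
rewrite !big_ord1; apply => y; rewrite !big_ord1; exact: P0.
Qed.

Lemma ketbra_bounded (H : hilbertType R) (x y : H) : bounded_op (ketbra x y).
Proof.
split; first by move=> a u v; rewrite /ketbra innerDr innerZr scalerDl scalerA.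
move=> z; apply: (@cvgZ C H _ _ _ (fun z => inner y z)); last exact: cvg_cst.
by apply: inner_cvg; [exact: cvg_cst|exact: cvg_id].
Qed.

Context {d : nat} (Q : bipartite R 'I_d 'I_d).
Local Notation e := (basisAB Q).
Local Notation slice := (@slice R 'I_d 'I_d Q).
Local Notation op := (Q -> Q).
Implicit Types (X P : op) (p q : 'I_d * 'I_d).

Lemma fin_expand (x : Q) : x = \sum_p inner (e p) x *: e p.
Proof.
apply: etrans (esym (sums_toE (@basisAB_expand _ _ _ Q x))) _.
by apply: sums_toE; exact: sums_to_pair.
Qed.

Lemma fin_parseval (x y : Q) : inner x y = \sum_p (inner (e p) x)^* * inner (e p) y :> C.
Proof.
rewrite {1}(fin_expand y) inner_sumr; apply: eq_bigr => p _.
by rewrite innerZr -inner_conj mulrC.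
Qed.

Lemma fin_linear_ext (V : lmodType C) (f g : Q -> V) : linear f -> linear g ->
  (forall p, f (e p) = g (e p)) -> f = g.
Proof.
move=> fl gl fg; apply/funext => x; rewrite (fin_expand x) !linear_prop_sum//.
by apply: eq_bigr => p _; rewrite !linear_propZ// fg.
Qed.

Lemma fin_linear_bounded X : linear X -> bounded_op X.
Proof.
move=> Xl; split=> //.
have -> : X = (fun x => \sum_p inner (e p) x *: X (e p)).
  apply/funext => x; rewrite {1}(fin_expand x) linear_prop_sum//.
  by apply: eq_bigr => p _; rewrite linear_propZ.
move=> x; apply: cvg_sum_seq => p.
exact: (ketbra_bounded (X (e p)) (e p)).2.
Qed.

Lemma fin_trace_bound X : psd X -> trace_bound X (complex.Re (\sum_p diag X p)).
Proof.
move=> pX s us.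
have d0 p : 0 <= diag X p by exact: psd_diag_ge0.
rewrite RRe_real; last by rewrite ger0_real// sumr_ge0.
by apply: ler_sum_sub => // p; rewrite mem_index_enum.
Qed.

Lemma fin_trace_class X : linear X -> (forall x, 0 <= inner x (X x)) -> trace_class X.
Proof.
move=> Xl X0; have pX : psd X by split=> //; exact: fin_linear_bounded.
exact/trace_class_psd/(trace_bound_finite pX)/fin_trace_bound.
Qed.

Lemma fin_trace X : trace X = \sum_p diag X p.
Proof. exact: (@sums_toE R _ C^o (diag X) _ (@sums_to_pair d C^o (diag X))). Qed.

Lemma fin_ptranspose X x :
  ptranspose X x = \sum_p slice p.1 p.2 (X (slice p.1 p.2 x)).
Proof. by apply: sums_toE; exact: sums_to_pair. Qed.

Lemma max_entangledE x :
  max_entangled Q x = d%:R^-1 *: \sum_i \sum_j inner (e (j, j)) x *: e (i, i).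
Proof.
have E i j : tens_op (ketbra (basisA Q i) (basisA Q j)) (ketbra (basisB Q i) (basisB Q j))
    = ketbra (e (i, i)) (e (j, j)).
  apply: tens_op_unique; first exact: ketbra_bounded.
  move=> a b; rewrite /ketbra /basisAB /= tens_inner -scalerA.
  by rewrite (linear_propZ (tens_linl _)) (linear_propZ (tens_linr _)).
rewrite /max_entangled.
under eq_bigr => i _ do under eq_bigr => j _ do rewrite E.
rewrite fct_sumE; congr (_ *: _); apply: eq_bigr => i _.
by rewrite fct_sumE.
Qed.

Lemma max_entangled_linear : linear (max_entangled Q).
Proof.
move=> a x y; rewrite !max_entangledE scalerA mulrC -scalerA -scalerDr; congr (_ *: _).
rewrite scaler_sumr -big_split; apply: eq_bigr => i _.
rewrite scaler_sumr -big_split; apply: eq_bigr => j _.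
by rewrite innerDr innerZr scalerDl scalerA.
Qed.

Lemma inner_max_entangled x :
  inner x (max_entangled Q x) = d%:R^-1 * `|\sum_i inner (e (i, i)) x| ^+ 2 :> C.
Proof.
rewrite max_entangledE innerZr; congr (_ * _).
rewrite normCK rmorph_sum mulr_sumr inner_sumr; apply: eq_bigr => i _.
rewrite inner_sumr mulr_suml; apply: eq_bigr => j _.
by rewrite innerZr [inner x _]inner_conj.
Qed.

Lemma max_entangled_trace_class : trace_class (max_entangled Q).
Proof.
apply: fin_trace_class => [|x]; first exact: max_entangled_linear.
by rewrite inner_max_entangled mulr_ge0 ?invr_ge0// exprn_ge0.
Qed.

Definition swap p := (p.2, p.1).

Lemma swapK : involutive swap. Proof. by case. Qed.

Definition flip (x : Q) : Q := \sum_p inner (e (swap p)) x *: e p.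

Lemma flip_linear : linear flip.
Proof.
move=> a x y; rewrite /flip scaler_sumr -big_split; apply: eq_bigr => p _.
by rewrite innerDr innerZr scalerDl scalerA.
Qed.

Lemma inner_flip p x : inner (e p) (flip x) = inner (e (swap p)) x.
Proof.
rewrite /flip inner_sumr (bigD1 p)//= big1 ?addr0 => [|q qp].
  by rewrite innerZr inner_basisAB eqxx mulr1.
by rewrite innerZr inner_basisAB eq_sym (negPf qp) mulr0.
Qed.

Lemma flip_basis p : flip (e p) = e (swap p).
Proof.
rewrite [RHS]fin_expand; apply: eq_bigr => q _.
by rewrite !inner_basisAB (can2_eq swapK swapK).
Qed.

(** Scaled by 1/d rather than 1/d^2, to match the normalization of Phi^d; on a space of dimension
    d^2 its trace is then d, the Schmidt rank to be recovered. *)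
Definition mixed : op := fun x => d%:R^-1 *: x.

(* (1 + s F) / d, a multiple of a projection when s = 1 or s = -1. *)
Definition flip_proj (s : C) : op := s *: (d%:R^-1 *: flip) + mixed.

Lemma mixed_linear : linear mixed.
Proof. by move=> a x y; rewrite /mixed scalerDr !scalerA mulrC. Qed.

Lemma flip_proj_linear s : linear (flip_proj s).
Proof.
apply: linear_comb => [|a x y]; last exact: mixed_linear.
by move=> a x y; rewrite !fctE /= flip_linear scalerDr !scalerA mulrC.
Qed.

Lemma mixed_trace_class : trace_class mixed.
Proof.
apply: fin_trace_class => [|x]; first exact: mixed_linear.
by rewrite innerZr mulr_ge0 ?invr_ge0// inner_ge0.
Qed.

(** F is a self-adjoint involution, so for such [s] the operator 1 + s F is half its own square. The
    sum of squares in the proof runs over the coordinates of (1 + s F) x. *)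
Lemma flip_proj_ge0 s x : s * s = 1 -> s^* = s -> 0 <= inner x (flip_proj s x) :> C.
Proof.
move=> ss sc.
have -> : inner x (flip_proj s x) = d%:R^-1 / 2 *
    \sum_p `|inner (e p) x + s * inner (e (swap p)) x| ^+ 2 :> C.
  have sw (F : 'I_d * 'I_d -> C) : \sum_p F p = \sum_p F (swap p).
    by rewrite (reindex_inj (inv_inj swapK)).
  have -> : inner x (flip_proj s x) = d%:R^-1 *
      (\sum_p `|inner (e p) x| ^+ 2 + s * \sum_p (inner (e p) x)^* * inner (e (swap p)) x).
    rewrite /flip_proj !fctE /= innerDr !innerZr mulrDr addrC mulrCA.
    rewrite fin_parseval [inner x (flip x)]fin_parseval.
    congr (_ * _ + _ * (_ * _)); apply: eq_bigr => p _; last by rewrite inner_flip.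
    by rewrite normCK mulrC.
  rewrite -mulrA; congr (_ * _).
  under [in RHS]eq_bigr => p _.
    rewrite normCK rmorphD rmorphM /= sc.
    have -> : forall a b a' b' : C, (a + s * b) * (a' + s * b') =
      a * a' + b * b' * (s * s) + s * (a' * b) + s * (b' * a) by move=> *; ring.
    rewrite ss mulr1 -!normCK.
    over.
  rewrite /= !big_split /= -!mulr_sumr.
  rewrite [X in _ = _ * (_ + X + _ + _)]sw [X in _ = _ * (_ + _ + _ + _ * X)]sw.
  under [X in _ = _ * (_ + X + _ + _)]eq_bigr => p _ do rewrite swapK.
  under [X in _ = _ * (_ + _ + _ + _ * X)]eq_bigr => p _ do rewrite swapK.
  by field.
by rewrite mulr_ge0 ?divr_ge0 ?invr_ge0// sumr_ge0// => p _; rewrite exprn_ge0.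
Qed.

(** On [e (m, k)] only the slices |i><k| act. For the identity just i = k survives; F sends
    [e (m, i)] to [e (i, m)], which survives for every i when m = k and adds up to d Phi^d. *)
Lemma ptranspose_flip_proj s : ptranspose (flip_proj s) = s *: max_entangled Q + mixed.
Proof.
have pl : linear (ptranspose (flip_proj s)).
  move=> a x y; rewrite !fin_ptranspose scaler_sumr -big_split; apply: eq_bigr => p _.
  by rewrite slice_linear flip_proj_linear slice_linear.
have rl : linear (s *: max_entangled Q + mixed).
  by apply: linear_comb; [exact: max_entangled_linear|exact: mixed_linear].
apply: fin_linear_ext pl rl _ => -[m k].
have sl := slice_linear.
have -> : (s *: max_entangled Q + mixed) (e (m, k)) =
    s *: max_entangled Q (e (m, k)) + mixed (e (m, k)) by [].
rewrite fin_ptranspose.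
rewrite -(pair_bigA _ (fun i j => slice i j (flip_proj s (slice i j (e (m, k)))))) /=.
have step i : \sum_j slice i j (flip_proj s (slice i j (e (m, k)))) =
    s *: (d%:R^-1 *: if m == k then e (i, i) else 0) +
    d%:R^-1 *: if i == k then e (m, i) else 0.
  rewrite (bigD1 k)//= big1 ?addr0 => [|j jk]; last first.
    rewrite slice_basisAB /= eq_sym (negPf jk).
    by rewrite (linear_prop0 (flip_proj_linear s)) (linear_prop0 (sl _ _ _ _ _ _)).
  rewrite slice_basisAB /= eqxx.
  have -> : flip_proj s (e (m, i)) = s *: (d%:R^-1 *: e (i, m)) + d%:R^-1 *: e (m, i).
    by rewrite /flip_proj -[e (i, m)]/(e (swap (m, i))) -flip_basis.
  by rewrite sl !(linear_propZ (sl _ _ _ _ _ _)) !slice_basisAB.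
rewrite (eq_bigr _ (fun i _ => step i)) big_split /=; congr (_ + _).
  rewrite max_entangledE !scaler_sumr; apply: eq_bigr => i _.
  congr (_ *: (_ *: _)); rewrite (bigD1 m)//= big1 ?addr0 => [|j jm].
    rewrite inner_basisAB xpair_eqE eqxx /=.
    by case: eqP => _; rewrite ?scale1r ?scale0r.
  by rewrite inner_basisAB xpair_eqE (negPf jm) scale0r.
rewrite -scaler_sumr /mixed; congr (_ *: _).
rewrite (bigD1 k)//= eqxx big1 ?addr0// => i ik.
by rewrite (negPf ik).
Qed.

Lemma trace_mixed : (0 < d)%N -> trace mixed = d%:R.
Proof.
move=> d0; rewrite fin_trace.
rewrite (eq_bigr (fun=> d%:R^-1)) => [|p _]; last first.
  by rewrite /diag /mixed innerZr inner_basisAB eqxx mulr1.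
rewrite sumr_const card_prod card_ord -[_ *+ (d * d)]mulr_natl natrM mulfK//.
by rewrite pnatr_eq0 -lt0n.
Qed.

End finite_dimension.

(** * From a PPT channel to a feasible operator *)

Section converse.
Context {R : realType} {I J : choiceType} {AB : bipartite R I J}.
Let C : numFieldType := R[i].
Variables (rho : AB -> AB) (hrho : is_state rho).

Definition kappa_feasible (S : AB -> AB) :=
  [/\ psd S, trace_class S, loewner_le (- ptranspose S) (ptranspose rho)
    & loewner_le (ptranspose rho) (ptranspose S)].

(** Partial transposition fixes the diagonal, so T_B(rho) <= T_B(S) compares the traces of rho and
    S. The bound allows division by Tr S when the channel is built. *)
Lemma kappa_feasible_trace S : kappa_feasible S -> 1 <= trace S.
Proof.
move=> [_ tS _ le]; have [_ tr tr1] := hrho.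
rewrite -subr_ge0 -tr1 addrC -mulN1r -trace_lin//.
apply: sums_to_ge0 (trace_sums (trace_class_lin (-1) tr tS)) _ => p.
have := le (basisAB AB p).
rewrite innerBr -/(diag (ptranspose rho) p) -/(diag (ptranspose S) p) !diag_ptranspose//.
by rewrite /diag innerDr innerZr mulN1r addrC.
Qed.

Lemma ppt_channel_feasible (d : nat) (Q : bipartite R 'I_d 'I_d)
    (L : (Q -> Q) -> (AB -> AB)) : (0 < d)%N -> ppt_channel L ->
  rho = L (max_entangled Q) ->
  exists2 S, kappa_feasible S & trace S = d%:R.
Proof.
move=> d0 [[Ltc Llin Ltr Lcp] Lppt] rhoE.
have tm := @mixed_trace_class _ _ Q; have tM := @max_entangled_trace_class _ _ Q.
exists (L (mixed (Q := Q))); last by rewrite Ltr// trace_mixed.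
(* The values 1 and -1 of [s] give the two operator inequalities of feasibility. *)
have pos (s : C) x : s * s = 1 -> s^* = s ->
    0 <= s * inner x (ptranspose rho x) + inner x (ptranspose (L (mixed (Q := Q))) x) :> C.
  move=> ss sc.
  have tP : trace_class (@flip_proj R d Q s).
    apply: fin_trace_class => [|y]; first exact: flip_proj_linear.
    exact: flip_proj_ge0.
  have := positive_of_cp Lppt (P := @flip_proj R d Q s) _ _ x.
  rewrite ptranspose_flip_proj Llin// ptranspose_lin; [|exact: Ltc..].
  rewrite -rhoE.
  have -> : (s *: ptranspose rho + ptranspose (L (mixed (Q := Q)))) x =
    s *: ptranspose rho x + ptranspose (L (mixed (Q := Q))) x by [].
  rewrite innerDr innerZr; apply.
    by split=> //=; rewrite ptranspose_flip_proj; exact: trace_class_lin.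
  by move=> y; exact: flip_proj_ge0.
split.
- split; first exact/trace_class_bounded/Ltc.
  apply: positive_of_cp Lcp tm _ => x.
  by rewrite innerZr mulr_ge0 ?invr_ge0// inner_ge0.
- exact: Ltc.
- move=> x; have := pos 1 x (mulr1 _) (rmorph1 _); rewrite mul1r.
  by rewrite innerBr innerNr opprK.
- move=> x.
  have := pos (-1) x (etrans (mulrNN 1 1) (mulr1 1))
    (etrans (rmorphN _ 1) (congr1 -%R (rmorph1 _))).
  by rewrite mulN1r innerBr addrC.
Qed.

End converse.

(** * The Hilbert spaces C^T *)

Section euclid_form.
Context {R : realType} {T : finType}.
Let C : numClosedFieldType := R[i].

(** The infimum in [E_ppt1] ranges over models of the code space, so achievability must exhibit one.
    An arbitrary finite index type lets one construction supply both C^d and its tensor square. *)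
Definition euclid : Type := {ffun T -> R[i]}.

HB.instance Definition _ := GRing.Lmodule.copy euclid {ffun T -> R[i]}.

Definition euclid_inner (x y : euclid) : R[i] := \sum_k (x k)^* * y k.

Lemma euclid_psd_form : psd_form euclid_inner.
Proof.
split=> [x a y z|x a y z|x].
- rewrite mulr_sumr -big_split; apply: eq_bigr => k _.
  by rewrite !ffunE mulrDr mulrCA.
- rewrite mulr_sumr -big_split; apply: eq_bigr => k _.
  by rewrite !ffunE rmorphD rmorphM mulrDl mulrA.
- by apply: sumr_ge0 => k _; rewrite mulrC mul_conjC_ge0.
Qed.

Lemma euclid_inner_ge0 x : 0 <= euclid_inner x x.
Proof. by case: euclid_psd_form. Qed.

Definition euclid_norm (x : euclid) : R[i] := sqrtC (euclid_inner x x).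

Lemma euclid_norm_ge0 x : 0 <= euclid_norm x.
Proof. by rewrite sqrtC_ge0 euclid_inner_ge0. Qed.

Lemma euclid_normZ (a : R[i]) (x : euclid) : euclid_norm (a *: x) = `|a| * euclid_norm x.
Proof.
apply: (@pexpIrn _ 2%N) => //; rewrite ?nnegrE ?mulr_ge0 ?euclid_norm_ge0//.
rewrite exprMn !sqrtCK mulr_sumr; apply: eq_bigr => k _.
by rewrite !ffunE normCK rmorphM /= mulrACA [a^* * a]mulrC.
Qed.

Lemma euclid_norm_eq0 x : euclid_norm x = 0 -> x = 0.
Proof.
move=> /eqP; rewrite sqrtC_eq0 => /eqP xx0.
apply/ffunP => k; rewrite ffunE; apply/eqP.
move/eqP: xx0; rewrite psumr_eq0 => [/allP /(_ k)|i _]; last first.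
  by rewrite mulrC mul_conjC_ge0.
by rewrite mem_index_enum => /(_ isT) /=; rewrite mulrC mul_conjC_eq0.
Qed.

(** The cross term is real and at most twice the modulus of the inner product, which Cauchy-Schwarz
    for [psd_form] bounds before the space has a norm. *)
Lemma euclid_normD x y : euclid_norm (x + y) <= euclid_norm x + euclid_norm y.
Proof.
rewrite -(@ler_pXn2r _ 2%N) ?nnegrE ?addr_ge0 ?euclid_norm_ge0//.
rewrite sqrrD !sqrtCK.
have -> : euclid_inner (x + y) (x + y) = euclid_inner x x
    + (euclid_inner x y + (euclid_inner x y)^*) + euclid_inner y y.
  rewrite -(psd_form_conj euclid_psd_form).
  have [Br Bl _] := euclid_psd_form.
  have := Br (x + y) 1 x y; rewrite scale1r mul1r => ->.
  have := Bl x 1 x y; have := Bl y 1 x y; rewrite scale1r rmorph1 !mul1r => -> ->.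
  by rewrite !addrA; congr (_ + _); rewrite -!addrA; congr (_ + _); rewrite addrC.
rewrite lerD2r lerD2l.
have zr : euclid_inner x y + (euclid_inner x y)^* \is Num.real.
  by rewrite CrealE rmorphD /= conjCK addrC.
apply: le_trans (real_ler_norm zr) _; apply: le_trans (ler_normD _ _) _.
rewrite norm_conjC -mulr2n ler_wMn2r//.
rewrite -(@ler_pXn2r _ 2%N) ?nnegrE ?mulr_ge0 ?euclid_norm_ge0//.
rewrite exprMn !sqrtCK; exact: psd_form_CS euclid_psd_form _ _.
Qed.

HB.instance Definition _ := @Lmodule_isNormed.Build R[i] euclid
  euclid_norm euclid_normD euclid_normZ euclid_norm_eq0.

End euclid_form.
Arguments euclid : clear implicits.

Section euclid_hilbert.
Context {R : realType} {T : finType}.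
Let C : numFieldType := R[i].
Local Notation V := (euclid R T).

Definition delta (k : T) : V := [ffun j => (j == k)%:R].

Lemma scale_delta (a : R[i]) k j : (a *: delta k : V) j = a * (j == k)%:R.
Proof. by rewrite !ffunE. Qed.

Lemma euclid_expand (x : V) : x = \sum_k x k *: delta k.
Proof.
apply/ffunP => j; rewrite sum_ffunE (bigD1 j)//= big1 ?addr0 => [|k kj].
  by rewrite scale_delta eqxx mulr1.
by rewrite scale_delta eq_sym (negPf kj) mulr0.
Qed.

Lemma euclid_inner_norm (x : V) : euclid_inner x x = `|x| ^+ 2.
Proof. by rewrite sqrtCK. Qed.

Lemma euclid_coord (x : V) k : `|x k| <= `|x|.
Proof.
rewrite -(@ler_pXn2r _ 2%N) ?nnegrE// -euclid_inner_norm /euclid_inner (bigD1 k)//=.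
rewrite mulrC -normCK lerDl sumr_ge0// => j _.
by rewrite mulrC mul_conjC_ge0.
Qed.

Lemma real_complex_cvg (U : Type) (F : set_system U) {FF : Filter F} (f : U -> R) (l : R) :
  f @ F --> l -> (fun t => (f t)%:C : C) @ F --> (l%:C : C).
Proof.
move=> /cvgrPdist_lt fl; apply/(@cvgrPdist_lt C C^o) => e e0.
have eE : e = (complex.Re e)%:C by rewrite RRe_real// gtr0_real.
have r0 : 0 < complex.Re e by move: e0; rewrite eE ltcR.
apply: filterS (fl _ r0) => t.
by rewrite -rmorphB eE normc_def /= expr0n addr0 sqrtr_sqr ltcR.
Qed.

Lemma cauchy_cvg_coord (F : set_system V) (f : V -> R) : ProperFilter F -> cauchy F ->
  (forall x y, (`|f x - f y|)%:C <= `|x - y|) -> cvg (f @ F).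
Proof.
move=> PF /(cauchyP F) cF fL; apply: cauchy_cvg; apply: cauchy_exP => e e0.
have [|x Fx] := cF e%:C; first by rewrite ltcR.
exists (f x); suff : F (f @^-1` ball (f x) e) by [].
apply: filterS Fx => y; rewrite /preimage -!ball_normE /ball_ /= => xy.
by rewrite -ltcR; apply: le_lt_trans (fL _ _) xy.
Qed.

(** Completeness is inherited from [R]: real and imaginary parts of the coordinates are 1-Lipschitz,
    so they converge along [F], and the expansion in [delta] reassembles the limit. *)
Lemma euclid_complete (F : set_system V) : ProperFilter F -> cauchy F -> cvg F.
Proof.
move=> PF cF.
have cRe k : cvg ((fun x : V => complex.Re (x k)) @ F).
  apply: cauchy_cvg_coord => // x y; apply: le_trans (euclid_coord (x - y) k).
  rewrite !ffunE -raddfB; exact: normc_ge_Re.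
have cIm k : cvg ((fun x : V => complex.Im (x k)) @ F).
  apply: cauchy_cvg_coord => // x y; apply: le_trans (euclid_coord (x - y) k).
  rewrite !ffunE -raddfB.
  rewrite normc_def lecR -sqrtr_sqr ler_wsqrtr// lerDr; exact: sqr_ge0.
pose l : V := [ffun k => (lim ((fun x : V => complex.Re (x k)) @ F))%:C
   + 'i * (lim ((fun x : V => complex.Im (x k)) @ F))%:C].
apply/cvg_ex; exists l; rewrite [l]euclid_expand.
have -> : F = (fun x : V => \sum_k x k *: delta k) @ F.
  rewrite (_ : (fun x : V => _) = id)//; apply/funext => x.
  by rewrite -euclid_expand.
apply: cvg_sum_seq => k; apply: (@cvgZ C V _ _ _ (fun x : V => x k)); last exact: cvg_cst.
rewrite ffunE; under eq_fun => x do rewrite (complexE (x k)).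
apply: cvgD; first exact: real_complex_cvg.
by apply: cvgM; [exact: cvg_cst|exact: real_complex_cvg].
Qed.

HB.instance Definition _ := Uniform_isComplete.Build V euclid_complete.

Lemma euclid_inner_linear (x : V) (a : R[i]) (y z : V) :
  euclid_inner x (a *: y + z) = a * euclid_inner x y + euclid_inner x z.
Proof. by case: (@euclid_psd_form R T). Qed.

Lemma euclid_inner_conj (x y : V) : euclid_inner y x = (euclid_inner x y)^*.
Proof. exact: psd_form_conj euclid_psd_form x y. Qed.

HB.instance Definition _ := @NormedModule_hasInner.Build R V
  (@euclid_inner R T) euclid_inner_linear euclid_inner_conj euclid_inner_norm.

Lemma inner_euclid (x y : V) : inner x y = \sum_k (x k)^* * y k.
Proof. by []. Qed.

Lemma delta_onb : @orthonormal_basis R V T delta.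
Proof.
split=> [i j|O [x Ox] _].
  rewrite inner_euclid (bigD1 i)//= big1 ?addr0 => [|k ki].
    by rewrite !ffunE eqxx rmorph1 mul1r.
  by rewrite !ffunE (negPf ki) rmorph0 mul0r.
by exists x; split=> //; exists (index_enum T), (fun k => x k); rewrite -euclid_expand.
Qed.

End euclid_hilbert.

Section euclid_bipartite.
Context {R : realType} (d : nat).
Local Notation V := (euclid R 'I_d).
Local Notation W := (euclid R ('I_d * 'I_d)%type).

Definition euclid_tens (a b : V) : W := [ffun p => a p.1 * b p.2].

Lemma euclid_tens_linl (b : V) : linear (euclid_tens^~ b).
Proof.
by move=> a x y; apply/ffunP => p; rewrite !ffunE mulrDl -scalerAl.
Qed.

Lemma euclid_tens_linr (a : V) : linear (euclid_tens a).
Proof.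
by move=> c x y; apply/ffunP => p; rewrite !ffunE mulrDr; congr (_ + _); exact: mulrCA.
Qed.

Lemma euclid_tens_inner (a b a' b' : V) :
  inner (euclid_tens a b) (euclid_tens a' b') = inner a a' * inner b b'.
Proof.
rewrite !inner_euclid mulr_suml.
under [RHS]eq_bigr => i _ do rewrite mulr_sumr.
rewrite pair_bigA; apply: eq_bigr => p _.
by rewrite !ffunE rmorphM mulrACA.
Qed.

Lemma euclid_tens_dense : dense [set x : W | exists s : seq (V * V),
  x = \sum_(p <- s) euclid_tens p.1 p.2].
Proof.
move=> O [x Ox] _; exists x; split=> //.
exists [seq (x p *: delta p.1, delta p.2) | p <- index_enum ('I_d * 'I_d)%type].
rewrite big_map {1}(euclid_expand x); apply: eq_bigr => p _.
apply/ffunP => q; rewrite !ffunE -[_ *: _]/(_ * _) -mulrA -natrM mulnb -xpair_eqE.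
by case: p q => [? ?] [? ?].
Qed.

Definition euclid_bipartite : bipartite R 'I_d 'I_d :=
  Bipartite euclid_tens_linl euclid_tens_linr euclid_tens_inner euclid_tens_dense
    delta_onb delta_onb.

End euclid_bipartite.

(** * Achievability *)

Section schur.
Context {R : realType}.
Let C : numFieldType := R[i].

Definition psd_matrix (k : nat) (A : 'I_k -> 'I_k -> C) :=
  forall c : 'I_k -> C, 0 <= \sum_a \sum_b (c a)^* * c b * A a b.

(* A Schur complement; if B w w = 0 then B u w = 0 too, in accordance with
   0^-1 = 0. *)
Lemma psd_form_deflate (V : lmodType C) (B : V -> V -> C) (w : V) : psd_form B ->
  psd_form (fun u v => B u v - B u w * B w v / B w w).
Proof.
move=> HB; have [Br Bl B0] := HB; split=> [x a y z|x a y z|x].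
- by rewrite !Br; ring.
- by rewrite !Bl; ring.
have := psd_form_CS HB x w; rewrite normCK -(psd_form_conj HB) subr_ge0 => CS.
have [->|w0] := eqVneq (B w w) 0; first by rewrite invr0 mulr0.
by rewrite ler_pdivrMr// lt_neqAle eq_sym w0 B0.
Qed.

Lemma psd_matrix_schur (k : nat) (A : 'I_k -> 'I_k -> C) (V : lmodType C)
    (B : V -> V -> C) (x : 'I_k -> V) : psd_matrix A -> psd_form B ->
  0 <= \sum_a \sum_b A a b * B (x a) (x b).
Proof.
move=> A0.
(* Deflating B at the x w one by one makes it vanish on all the x a; the rank
   one terms split off are nonnegative since A is. *)
suff H (t : seq 'I_k) B' : psd_form B' -> (forall a, a \notin t -> B' (x a) (x a) = 0) ->
    0 <= \sum_a \sum_b A a b * B' (x a) (x b).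
  by move=> HB; apply: (H (enum 'I_k)) => // a; rewrite mem_enum.
elim: t B' => [|w t IH] B' HB Bt.
  rewrite big1// => a _; rewrite big1// => b _.
  by rewrite (psd_form_null HB) ?mulr0 ?Bt.
have [_ _ B0] := HB.
pose B2 u v := B' u v - B' u (x w) * B' (x w) v / B' (x w) (x w).
have HB2 : psd_form B2 by exact: psd_form_deflate.
have E a b : A a b * B' (x a) (x b) = A a b * B2 (x a) (x b) +
    (B' (x w) (x w))^-1 * ((B' (x w) (x a))^* * B' (x w) (x b) * A a b).
  by rewrite -(psd_form_conj HB) /B2; ring.
under eq_bigr => a _ do under eq_bigr => b _ do rewrite E.
under eq_bigr => a _ do rewrite big_split /= -mulr_sumr.
rewrite big_split /= -mulr_sumr addr_ge0//; last first.
  by rewrite mulr_ge0 ?invr_ge0 ?B0//; exact: A0.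
apply: IH => // a at_; have [aw|aw] := eqVneq a w.
  rewrite aw /B2; have [->|w0] := eqVneq (B' (x w) (x w)) 0.
    by rewrite !mul0r subrr.
  by rewrite mulfK// subrr.
have Ba : B' (x a) (x a) = 0 by apply: Bt; rewrite inE negb_or aw.
by rewrite /B2 !(psd_form_null HB _ Ba) !mul0r subrr.
Qed.

(** Complete positivity of [f] as a map into the scalars. The blocks are linear because the
    functionals below become sums of quadratic forms on linear operators only. *)
Definition positive_functional (H : hilbertType R) (f : (H -> H) -> C) :=
  forall k (X : 'I_k -> 'I_k -> H -> H), (forall a b, linear (X a b)) ->
    block_psd X -> psd_matrix (fun a b => f (X a b)).

Section functionals.
Context {H : hilbertType R}.
Implicit Types f g : (H -> H) -> C.

Lemma positive_functional_eq f g : (forall X, linear X -> f X = g X) ->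
  positive_functional g -> positive_functional f.
Proof.
move=> fg g0 k X lX X0 c.
under eq_bigr => a _ do under eq_bigr => b _ do rewrite fg//.
exact: g0.
Qed.

Lemma positive_functional_lin (u : C) f g : 0 <= u -> positive_functional f ->
  positive_functional g -> positive_functional (fun X => u * f X + g X).
Proof.
move=> u0 f0 g0 k X lX X0 c.
have -> : \sum_a \sum_b (c a)^* * c b * (u * f (X a b) + g (X a b)) =
    u * (\sum_a \sum_b (c a)^* * c b * f (X a b)) +
    \sum_a \sum_b (c a)^* * c b * g (X a b).
  rewrite mulr_sumr -big_split; apply: eq_bigr => a _.
  rewrite mulr_sumr -big_split; apply: eq_bigr => b _.
  by rewrite mulrDr mulrCA.
by rewrite addr_ge0 ?mulr_ge0//; [exact: f0|exact: g0].
Qed.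

Lemma positive_functional0 : positive_functional (fun _ : H -> H => 0).
Proof.
by move=> k X _ _ c; rewrite big1// => a _; rewrite big1// => b _; rewrite mulr0.
Qed.

Lemma positive_functionalZ (u : C) f : 0 <= u -> positive_functional f ->
  positive_functional (fun X => u * f X).
Proof.
move=> u0 f0.
apply: positive_functional_eq (positive_functional_lin u0 f0 positive_functional0).
by move=> X _; rewrite addr0.
Qed.

Lemma positive_functional_sum (K : Type) (s : seq K) (P : pred K) (f : K -> (H -> H) -> C) :
  (forall k, positive_functional (f k)) ->
  positive_functional (fun X => \sum_(k <- s | P k) f k X).
Proof.
move=> f0; elim: s => [|k s IH].
  by apply: positive_functional_eq positive_functional0 => X _; rewrite big_nil.
case Pk : (P k); last first.
  by apply: positive_functional_eq IH => X _; rewrite big_cons Pk.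
apply: positive_functional_eq (positive_functional_lin ler01 (f0 k) IH) => X _.
by rewrite big_cons Pk mul1r.
Qed.

(** The block is tested on the vectors [c a *: v]. All functionals below are nonnegative
    combinations of functionals of this kind. *)
Lemma positive_functional_inner (v : H) : positive_functional (fun X => inner v (X v)).
Proof.
move=> k X lX X0 c; have := X0 (fun a => c a *: v).
under eq_bigr => a _ do
  (under eq_bigr => b _ do rewrite (linear_propZ (lX a b)) innerZl innerZr mulrA).
by [].
Qed.

End functionals.

(** Two terms cover both uses: the channel itself, with rho and S, and its conjugate by partial
    transposition, with Y+ and Y-. *)
Lemma completely_positive_two (H K : hilbertType R) (D : set (H -> H))
    (N : (H -> H) -> (K -> K)) (f g : (H -> H) -> C) (Y Z : K -> K) :
  (forall X, D X -> linear X) ->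
  (forall X x, D X -> N X x = f X *: Y x + g X *: Z x) ->
  positive_functional f -> positive_functional g ->
  linear Y -> (forall x, 0 <= inner x (Y x)) ->
  linear Z -> (forall x, 0 <= inner x (Z x)) ->
  completely_positive D N.
Proof.
move=> Dl NE f0 g0 Yl Y0 Zl Z0 k X DX X0 x.
have lX a b : linear (X a b) by exact: Dl.
have -> : \sum_a \sum_b inner (x a) (N (X a b) (x b)) =
    \sum_a \sum_b f (X a b) * inner (x a) (Y (x b)) +
    \sum_a \sum_b g (X a b) * inner (x a) (Z (x b)).
  rewrite -big_split; apply: eq_bigr => a _; rewrite -big_split; apply: eq_bigr => b _.
  by rewrite NE// innerDr !innerZr.
apply: addr_ge0.
- exact: psd_matrix_schur (f0 _ _ lX X0) (psd_psd_form Yl Y0).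
- exact: psd_matrix_schur (g0 _ _ lX X0) (psd_psd_form Zl Z0).
Qed.

End schur.

(** * Functionals given by Phi^d, by its complement and by the flip *)

Section functionals_on_code_space.
Context {R : realType} {d : nat} (Q : bipartite R 'I_d 'I_d).
Let C : numFieldType := R[i].
Local Notation e := (basisAB Q).
Implicit Types X : Q -> Q.

(** The trace as a finite sum, so that linearity holds for arbitrary functions; [fin_trace]
    identifies it with [trace]. *)
Definition diag_sum X : C := \sum_p diag X p.

(* Tr(Phi^d X) *)
Definition fidelity X : C := d%:R^-1 * \sum_i \sum_j inner (e (i, i)) (X (e (j, j))).

(* Tr(F X) *)
Definition flip_sum X : C := \sum_p inner (e p) (X (e (swap p))).

Lemma diag_sum_lin (a : C) X Y : diag_sum (a *: X + Y) = a * diag_sum X + diag_sum Y.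
Proof.
rewrite /diag_sum mulr_sumr -big_split; apply: eq_bigr => p _.
by rewrite /diag innerDr innerZr.
Qed.

Lemma fidelity_lin (a : C) X Y : fidelity (a *: X + Y) = a * fidelity X + fidelity Y.
Proof.
rewrite /fidelity mulrCA -mulrDr; congr (_ * _).
rewrite mulr_sumr -big_split; apply: eq_bigr => i _.
rewrite mulr_sumr -big_split; apply: eq_bigr => j _.
by rewrite innerDr innerZr.
Qed.

Lemma fidelityE X : linear X ->
  fidelity X = d%:R^-1 * inner (\sum_i e (i, i)) (X (\sum_i e (i, i))).
Proof.
move=> lX; congr (_ * _); rewrite inner_suml; apply: eq_bigr => i _.
by rewrite linear_prop_sum// inner_sumr.
Qed.

Lemma fidelity_max_entangled : (0 < d)%N -> fidelity (max_entangled Q) = 1.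
Proof.
move=> d0; have dn : d%:R != 0 :> C by rewrite pnatr_eq0 -lt0n.
rewrite fidelityE; last exact: max_entangled_linear.
rewrite inner_max_entangled.
have -> : \sum_i inner (e (i, i)) (\sum_j e (j, j)) = d%:R :> C.
  rewrite (eq_bigr (fun=> 1)) ?sumr_const ?card_ord// => i _.
  rewrite inner_sumr (bigD1 i)//= inner_basisAB eqxx big1 ?addr0// => j ji.
  by rewrite inner_basisAB xpair_eqE eq_sym (negPf ji).
by rewrite normr_nat expr2 mulKf// mulVf.
Qed.

Lemma diag_sum_max_entangled : (0 < d)%N -> diag_sum (max_entangled Q) = 1.
Proof.
move=> d0; have dn : d%:R != 0 :> C by rewrite pnatr_eq0 -lt0n.
have E i j : diag (max_entangled Q) (i, j) = if j == i then d%:R^-1 else 0.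
  rewrite /diag inner_max_entangled.
  case: eqVneq => [->|ji].
    rewrite (bigD1 i)//= inner_basisAB eqxx big1 ?addr0 ?normr1 ?expr1n ?mulr1// => k ki.
    by rewrite inner_basisAB xpair_eqE (negPf ki).
  rewrite big1 ?normr0 ?expr0n ?mulr0// => k _.
  rewrite inner_basisAB xpair_eqE; case: eqVneq => //= ki.
  by rewrite ki eq_sym (negPf ji).
rewrite /diag_sum -(pair_bigA _ (fun i j => diag (max_entangled Q) (i, j))) /=.
rewrite (eq_bigr (fun=> d%:R^-1)) => [|i _]; last first.
  rewrite (bigD1 i)//= E eqxx big1 ?addr0// => j ji.
  by rewrite E (negPf ji).
by rewrite sumr_const card_ord -[_ *+ d]mulr_natl mulfV.
Qed.

Lemma fidelity_positive : positive_functional fidelity.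
Proof.
apply: positive_functional_eq fidelityE _.
by apply: positive_functionalZ; [rewrite invr_ge0|exact: positive_functional_inner].
Qed.

(** 1 - Phi^d is the projection onto the span of the [e (i, j)] with i != j, plus 1/(2d) times the
    sum of the |v><v| over all v = e (i, i) - e (j, j). *)
Lemma cofidelity_positive : (0 < d)%N ->
  positive_functional (fun X => diag_sum X - fidelity X).
Proof.
move=> d0; have dn : d%:R != 0 :> C by rewrite pnatr_eq0 -lt0n.
pose g X := 1 * (\sum_(p | p.1 != p.2) inner (e p) (X (e p))) +
  (2 * d%:R)^-1 * \sum_i \sum_j
    inner (e (i, i) - e (j, j)) (X (e (i, i) - e (j, j))).
apply: (@positive_functional_eq _ _ _ g) => [X lX|]; last first.
  apply: positive_functional_lin => //.
    by apply: positive_functional_sum => p; exact: positive_functional_inner.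
  apply: positive_functionalZ; first by rewrite invr_ge0 mulr_ge0.
  apply: positive_functional_sum => i; apply: positive_functional_sum => j.
  exact: positive_functional_inner.
rewrite /g mul1r /diag_sum (bigID (fun p => p.1 != p.2)) /= -addrA; congr (_ + _).
have -> : \sum_(p | ~~ (p.1 != p.2)) diag X p = \sum_i diag X (i, i).
  transitivity (\sum_i \sum_(j | i == j) diag X (i, j)).
    by rewrite pair_big_dep; apply: eq_big => [[i j]|[i j]]; rewrite //= negbK.
  by apply: eq_bigr => i _; rewrite (big_pred1 i)// => j; rewrite eq_sym.
pose t i j := inner (e (i, i)) (X (e (j, j))) : C.
have E i j : inner (e (i, i) - e (j, j)) (X (e (i, i) - e (j, j))) =
    t i i + t j j - t i j - t j i.
  by rewrite (linear_propB lX) innerBl !innerBr /t; ring.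
under [in RHS]eq_bigr => i _ do under eq_bigr => j _ do rewrite E.
under [in RHS]eq_bigr => i _ do rewrite !big_split /= !sumrN sumr_const card_ord.
rewrite !big_split /= !sumrN sumr_const card_ord.
rewrite [X in _ = _ * (_ - X)]exchange_big /= /fidelity -/t.
rewrite -[\sum_i \sum_j inner _ _]/(\sum_i \sum_j t i j).
under [X in _ = _ * (X + _ - _ - _)]eq_bigr => i _ do rewrite -[t i i *+ d]mulr_natl.
rewrite -mulr_sumr -[_ *+ d]mulr_natl.
rewrite -[\sum_i diag X (i, i)]/(\sum_i t i i).
by field.
Qed.

(** With v_p = e p + s e (swap p), the sum of the |v_p><v_p| is (1 + s F)^2 = 2 (1 + s F), which
    explains the factor 1/4 in the proof. *)
Lemma flip_sum_positive (s : C) : s * s = 1 -> s^* = s ->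
  positive_functional (fun X => 2^-1 * (diag_sum X + s * flip_sum X)).
Proof.
move=> ss sc.
apply: (@positive_functional_eq _ _ _ (fun X => 4^-1 * \sum_p
    inner (e p + s *: e (swap p)) (X (e p + s *: e (swap p))))) => [X lX|]; last first.
  apply: positive_functionalZ; first by rewrite invr_ge0.
  by apply: positive_functional_sum => p; exact: positive_functional_inner.
have E p : inner (e p + s *: e (swap p)) (X (e p + s *: e (swap p))) =
    diag X p + diag X (swap p)
    + s * inner (e p) (X (e (swap p))) + s * inner (e (swap p)) (X (e (swap (swap p)))).
  rewrite swapK (linear_propD lX) (linear_propZ lX) innerDl !innerDr !innerZl !innerZr sc.
  by rewrite mulrA ss mul1r /diag; ring.
under [in RHS]eq_bigr => p _ do rewrite E.
rewrite !big_split /= -!mulr_sumr.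
have sw (F : 'I_d * 'I_d -> C) : \sum_p F (swap p) = \sum_p F p.
  by rewrite [RHS](reindex_inj (inv_inj swapK)).
rewrite sw (sw (fun p => inner (e p) (X (e (swap p))))) -/(diag_sum X) -/(flip_sum X).
by field.
Qed.

(** The entry of T_B(X) at (ii, jj) is the entry of X at (ij, ji), so pairing with Phi^d becomes
    pairing with F/d. *)
Lemma fidelity_ptranspose X : trace_class X ->
  fidelity (ptranspose X) = d%:R^-1 * flip_sum X.
Proof.
move=> tX; congr (_ * _).
rewrite /flip_sum -(pair_bigA _ (fun i j => inner (e (i, j)) (X (e (j, i))))) /=.
apply: eq_bigr => i _; apply: eq_bigr => j _.
have X0 := linear_prop0 (trace_class_bounded tX).1.
rewrite -(sums_toE (inner_ptranspose tX)).
pose K : choiceType := (('I_d : choiceType) * ('I_d : choiceType))%type.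
apply: etrans (sums_toE (@sums_to1 R K C^o _ (i, j) _)) _ => [[k l]|].
  rewrite !slice_basisAB /= xpair_eqE.
  case: (eqVneq i k) => [<-|_]; last by rewrite inner0l.
  case: (eqVneq j l) => [<-|_]; last by rewrite X0 inner0r.
  by [].
by rewrite !slice_basisAB /= !eqxx.
Qed.

Lemma diag_sum_ptranspose X : trace_class X -> diag_sum (ptranspose X) = diag_sum X.
Proof. by move=> tX; apply: eq_bigr => p _; exact: diag_ptranspose. Qed.

End functionals_on_code_space.

(** * The channel built from a feasible operator *)

Section achievability.
Context {R : realType} {I J : choiceType} {AB : bipartite R I J}.
Let C : numFieldType := R[i].
Variables (rho : AB -> AB) (hrho : is_state rho) (S : AB -> AB).
Hypothesis hS : kappa_feasible rho S.
Variables (d : nat) (Q : bipartite R 'I_d 'I_d).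

Definition dilution_weight (X : Q -> Q) : C := (trace S)^-1 * (diag_sum X - fidelity X).

(** A measure-and-prepare map: the input is tested for Phi^d, and the outcome decides between the
    state rho and the normalized S. *)
Definition dilution (X : Q -> Q) : AB -> AB :=
  fidelity X *: rho + dilution_weight X *: S.

Hypothesis hd : trace S + 1 <= d%:R :> C.

Let psdS : psd S. Proof. by case: hS. Qed.
Let tcS : trace_class S. Proof. by case: hS. Qed.
Let tcrho : trace_class rho. Proof. by case: hrho. Qed.
Let trS_ge1 : 1 <= trace S :> C. Proof. exact: kappa_feasible_trace hS. Qed.
Let trS_gt0 : 0 < trace S :> C. Proof. exact: lt_le_trans trS_ge1. Qed.
Let d_gt0 : (0 < d)%N.
Proof. by rewrite -(ltr0n C); apply: lt_le_trans hd; rewrite addr_gt0. Qed.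
Let dC_gt0 : 0 < d%:R :> C. Proof. by rewrite ltr0n. Qed.

Lemma dilution_weight_lin (a : C) X Y :
  dilution_weight (a *: X + Y) = a * dilution_weight X + dilution_weight Y.
Proof. by rewrite /dilution_weight diag_sum_lin fidelity_lin; ring. Qed.

Lemma dilution_trace_class X : trace_class (dilution X).
Proof. by apply: trace_class_lin => //; exact: trace_classZ. Qed.

Lemma dilution_max_entangled : dilution (max_entangled Q) = rho.
Proof.
rewrite /dilution /dilution_weight fidelity_max_entangled// diag_sum_max_entangled//.
by rewrite subrr mulr0 scale0r addr0 scale1r.
Qed.

Lemma dilution_channel : is_channel dilution.
Proof.
split.
- by move=> X _; exact: dilution_trace_class.
- move=> a X Y _ _; rewrite /dilution fidelity_lin dilution_weight_lin.
  by rewrite !scalerDl scalerDr !scalerA addrACA.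
- move=> X _; rewrite /dilution trace_lin ?traceZ//; last exact: trace_classZ.
  have [_ _ ->] := hrho; rewrite fin_trace /dilution_weight -/(diag_sum X).
  have S0 : trace S != 0 :> C by rewrite gt_eqF.
  by field.
apply: (@completely_positive_two _ _ _ _ _ (@fidelity _ _ Q) dilution_weight rho S).
- by move=> X /trace_class_bounded[].
- by [].
- exact: fidelity_positive.
- apply: positive_functionalZ; first by rewrite invr_ge0 ltW.
  exact: cofidelity_positive.
- by have [[[]]] := hrho.
- by have [[_ ? _ _]] := hrho.
- by have [[]] := psdS.
- by have [] := psdS.
Qed.

Lemma dilution_ppt_positive : completely_positive
  [set X : Q -> Q | trace_class X /\ trace_class (ptranspose X)]
  (fun X => ptranspose (dilution (ptranspose X))).
Proof.
pose m : C := trace S; pose u : C := d%:R^-1.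
have m0 : m != 0 by rewrite gt_eqF.
have d0 : d%:R != 0 :> C by rewrite gt_eqF.
(* Tr X and Tr(F X) are the sum and the difference of Tr(P+ X) and Tr(P- X); collecting terms gives
   these coefficients, with [Y 1] and [Y (-1)] in the roles of Y+ and Y-. *)
pose Y (s : C) : AB -> AB :=
  (s * u) *: ptranspose rho + (m^-1 * (1 - s * u)) *: ptranspose S.
have Yl s : linear (Y s).
  apply: linear_comb; first exact: ptranspose_linear.
  move=> a x y; rewrite !fctE /= ptranspose_linear//.
  by rewrite scalerDr !scalerA mulrC.
have pos x : 0 <= inner x (ptranspose S x) + inner x (ptranspose rho x) :> C
           /\ 0 <= inner x (ptranspose S x) - inner x (ptranspose rho x) :> C.
  have [_ _ h1 h2] := hS; split.
    by have := h1 x; rewrite innerBr innerNr opprK addrC.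
  by have := h2 x; rewrite innerBr.
(* The two feasibility inequalities add up to 2 T_B(S) >= 0; positivity of S itself does not pass to
   its partial transpose in general. *)
have S0 x : 0 <= inner x (ptranspose S x) :> C.
  have [h1 h2] := pos x.
  have := addr_ge0 h1 h2; rewrite addrACA subrr addr0 -mulr2n.
  by rewrite pmulrn_lge0.
have YE s x : inner x (Y s x) = s * u * inner x (ptranspose rho x) +
    m^-1 * (1 - s * u) * inner x (ptranspose S x) :> C.
  by rewrite /Y innerDr !innerZr.
have u0 : 0 <= u by rewrite invr_ge0.
have um0 : 0 <= u * m^-1 by rewrite mulr_ge0// invr_ge0 ltW.
apply: (@completely_positive_two _ _ _ _ _
  (fun X => 2^-1 * (diag_sum X + 1 * flip_sum X))
  (fun X => 2^-1 * (diag_sum X + (-1) * flip_sum X)) (Y 1) (Y (-1))).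
- by move=> X [/trace_class_bounded[]].
- move=> X x [tX tTX].
  rewrite /dilution ptranspose_lin ?ptransposeZ//; last exact: trace_classZ.
  rewrite /dilution_weight fidelity_ptranspose// diag_sum_ptranspose//.
  have -> : (((d%:R)^-1 * flip_sum X) *: ptranspose rho +
     (m^-1 * (diag_sum X - (d%:R)^-1 * flip_sum X)) *: ptranspose S) x =
    ((d%:R)^-1 * flip_sum X) *: ptranspose rho x +
     (m^-1 * (diag_sum X - (d%:R)^-1 * flip_sum X)) *: ptranspose S x by [].
  have YE' s : Y s x = (s * u) *: ptranspose rho x + (m^-1 * (1 - s * u)) *: ptranspose S x.
    by [].
  rewrite !YE' !scalerDr !scalerA addrACA -!scalerDl.
  by congr (_ *: _ + _ *: _); rewrite /u; field; rewrite ?m0 ?d0.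
- by apply: flip_sum_positive; rewrite ?mulr1 ?rmorph1.
- by apply: flip_sum_positive; rewrite ?mulrNN ?mulr1 ?rmorphN ?rmorph1.
- exact: Yl.
- move=> x; rewrite YE mul1r; have [h1 h2] := pos x.
  (* The first summand absorbs T_B(S)/d; what remains of T_B(S) has coefficient (d - 1 - m)/(d m),
     nonnegative by [hd]. *)
  have -> : u * inner x (ptranspose rho x) + m^-1 * (1 - u) * inner x (ptranspose S x) =
      u * (inner x (ptranspose S x) + inner x (ptranspose rho x)) +
      u * m^-1 * (d%:R - (m + 1)) * inner x (ptranspose S x).
    by rewrite /u; field; rewrite ?m0 ?d0.
  apply: addr_ge0; first exact: mulr_ge0.
  by apply: mulr_ge0 => //; rewrite mulr_ge0 ?um0// subr_ge0; exact: hd.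
- exact: Yl.
- move=> x; rewrite YE mulN1r; have [h1 h2] := pos x.
  (* With the opposite sign the remaining coefficient is (d + 1 - m)/(d m), larger than the previous
     one by 2/(d m). *)
  have -> : - u * inner x (ptranspose rho x) + m^-1 * (1 - - u) * inner x (ptranspose S x) =
      u * (inner x (ptranspose S x) - inner x (ptranspose rho x)) +
      u * m^-1 * (d%:R - (m + 1) + 2) * inner x (ptranspose S x).
    by rewrite /u; field; rewrite ?m0 ?d0.
  apply: addr_ge0; first exact: mulr_ge0.
  by apply: mulr_ge0 => //; rewrite mulr_ge0 ?um0// addr_ge0// subr_ge0; exact: hd.
Qed.

Lemma dilution_ppt_channel : ppt_channel dilution.
Proof. by split; [exact: dilution_channel|exact: dilution_ppt_positive]. Qed.

End achievability.

(** * Base 2 logarithm and exponential on the extended reals *)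

Section logarithms.
Context {R : realType}.
Local Open Scope ereal_scope.
Implicit Types x y : \bar R.

Let ln2_gt0 : (0 < ln 2 :> R)%R. Proof. by rewrite ln_gt0// ltr1n. Qed.

(** [lne] is -oo at nonpositive arguments, so monotonicity extends to the whole line and differences
    such as [exp2 _ - 1] raise no sign condition. *)
Lemma le_log2 x y : x <= y -> log2 x <= log2 y.
Proof.
move=> xy; apply: lee_wpmul2r; first by rewrite lee_fin invr_ge0 ltW.
have [x0|x0] := leP x 0; first by rewrite (le0_lneNy x0) leNye.
by rewrite lee_lne// in_itv /= leey andbT ltW// (lt_le_trans x0 xy).
Qed.

Lemma exp2K : cancel (@exp2 R) log2.
Proof.
by move=> x; rewrite /log2 /exp2 expeRK -muleA -EFinM divff ?mule1// gt_eqF.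
Qed.

Lemma le_exp2 x y : x <= y -> exp2 x <= exp2 y.
Proof. by move=> xy; rewrite lee_expeR lee_wpmul2r// lee_fin ltW. Qed.

Lemma le_exp2_log2 x : x <= exp2 (log2 x).
Proof.
rewrite /log2 /exp2 -muleA -EFinM mulVf ?gt_eqF// mule1.
have [x0|x0] := leP x 0; first by rewrite (le_trans x0)// expeR_ge0.
by rewrite lneK// in_itv /= leey ltW.
Qed.

Lemma log2K x : 0 <= x -> exp2 (log2 x) = x.
Proof.
move=> x0; rewrite /log2 /exp2 -muleA -EFinM mulVf ?gt_eqF// mule1.
by rewrite lneK// in_itv /= leey andbT.
Qed.

End logarithms.

Theorem proposition2 (R : realType) (I J : choiceType) (AB : bipartite R I J)
    (hsep : separable AB) (rho : AB -> AB) (hrho : is_state rho) :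
  (log2 (exp2 (E_kappa rho) - 1) <= E_ppt1 rho /\
   E_ppt1 rho <= log2 (exp2 (E_kappa rho) + 2%:E))%E.
Proof.
split.
  apply: (@le_trans _ _ (E_kappa rho)).
    by rewrite -{2}[E_kappa rho]exp2K; apply: le_log2; rewrite leeBlDr// leeDl.
  apply: le_ereal_inf_tmp => _ [d [Q [L [d0 pptL rhoE ->]]]].
  have [S hS trS] := ppt_channel_feasible d0 pptL rhoE.
  apply: ereal_inf_lbound; exists S => //.
  by rewrite trS -(rmorph_nat (real_complex R)).
(* Moving 2 to the left leaves [E_kappa] alone on the right, so its infimum can be treated one S at
   a time: it suffices that [exp2 (E_ppt1 rho)] be at most Tr S + 2 for each feasible S. *)
rewrite -[E_ppt1 rho]exp2K; apply: le_log2; rewrite -leeBlDr//.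
apply: le_trans (le_exp2_log2 _) _; apply: le_exp2.
apply: le_ereal_inf_tmp => _ [S hS <-]; apply: le_log2; rewrite leeBlDr//.
have trS1 := kappa_feasible_trace hrho hS.
set m := complex.Re (trace S).
have trSE : trace S = m%:C.
  by rewrite /m RRe_real// ger0_real// (le_trans ler01 trS1).
have m0 : 0 <= m by rewrite -ler0c -trSE (le_trans ler01 trS1).
have /andP[dm md] := truncn_itv m0.
(* As [truncn] rounds down, m + 1 < d <= m + 2: the left bound is what the channel requires, the
   right one yields the additive 2. *)
pose d := (Num.truncn m).+2.
have hd : trace S + 1 <= d%:R.
  rewrite trSE -(rmorph_nat (real_complex R)) -(rmorph1 (real_complex R)) -rmorphD lecR.
  by rewrite /d -natr1 lerD2r ltW.
have m2 : (0 <= (m + 2)%:E)%E by rewrite lee_fin addr_ge0.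
rewrite -EFinD -(log2K m2); apply: le_exp2.
apply: (@le_trans _ _ (log2 (d%:R)%:E)).
  apply: ereal_inf_lbound; exists d, (@euclid_bipartite R d), (dilution rho S (Q := _)).
  split=> //; first exact: dilution_ppt_channel.
  by rewrite dilution_max_entangled.
by apply: le_log2; rewrite lee_fin /d -addn2 natrD lerD2r.
Qed.
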